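(* The map $\widetilde{p}\circ\Phi:\mathfrak{T}/{\equiv}\to\mathfrak{P}/{\equiv}$ is bijective. Moreover, $\Psi\circ(\widetilde{p})^{-1}$ is the inverse map of $\widetilde{p}\circ\Phi$. Hence there is a one-to-one correspondence between $\mathfrak{T}/{\equiv}$ and $\mathfrak{P}/{\equiv}$.
   Context: An involution on a real Lie algebra $\mathfrak{l}$ is a Lie algebra automorphism $\nu$ with $\nu^2=\operatorname{id}$; $\mathfrak{l}^{\nu}$ and $\mathfrak{l}^{-\nu}$ denote its $(+1)$- and $(-1)$-eigenspaces. Involutions are extended $\mathbb{C}$-linearly to complexifications, and the restrictions to real forms below are restrictions of these extensions. $\mathfrak{P}$ is the set of non-compact semisimple symmetric pairs $(\mathfrak{g}_0,\sigma)$, where $\mathfrak{g}_0$ is a non-compact real semisimple Lie algebra and $\sigma$ an involution on it. $(\mathfrak{g}_0,\sigma)\equiv(\mathfrak{g}_0',\sigma')$ means there is a Lie algebra isomorphism $\varphi:\mathfrak{g}_0\to\mathfrak{g}_0'$ with $\varphi\sigma=\sigma'\varphi$. $\mathfrak{P}_c$ is the set of non-compact semisimple symmetric pairs equipped with Cartan involutions, i.e. triplets $(\mathfrak{g}_0,\sigma;\theta)$ with $(\mathfrak{g}_0,\sigma)\in\mathfrak{P}$ and $\theta$ a Cartan involution of $\mathfrak{g}_0$ with $\theta\sigma=\sigma\theta$. $(\mathfrak{g}_0,\sigma;\theta)\equiv(\mathfrak{g}_0',\sigma';\theta')$ means there is a Lie algebra isomorphism $\varphi:\mathfrak{g}_0\to\mathfrak{g}_0'$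 with $\varphi\sigma=\sigma'\varphi$ and $\varphi\theta=\theta'\varphi$. $\mathfrak{T}$ is the set of commutative compact semisimple symmetric triads $(\mathfrak{g},\theta_1,\theta_2)$, where $\mathfrak{g}$ is a compact semisimple Lie algebra and $\theta_1,\theta_2$ are involutions on $\mathfrak{g}$ with $\theta_1\theta_2=\theta_2\theta_1$. $(\mathfrak{g},\theta_1,\theta_2)\equiv(\mathfrak{g}',\theta_1',\theta_2')$ means there is a Lie algebra isomorphism $\psi:\mathfrak{g}\to\mathfrak{g}'$ with $\psi\theta_1=\theta_1'\psi$ and $\psi\theta_2=\theta_2'\psi$. The map $\widetilde{p}:\mathfrak{P}_c/{\equiv}\to\mathfrak{P}/{\equiv}$ is induced by $(\mathfrak{g}_0,\sigma;\theta)\mapsto(\mathfrak{g}_0,\sigma)$; it is known to be bijective. The map $\Phi:\mathfrak{T}/{\equiv}\to\mathfrak{P}_c/{\equiv}$ is induced by $$(\mathfrak{g},\theta_1,\theta_2)\mapsto(\mathfrak{g}_0,\ \theta_2|_{\mathfrak{g}_0};\ \theta_1|_{\mathfrak{g}_0}),\qquad \mathfrak{g}_0:=\mathfrak{g}^{\theta_1}+\sqrt{-1}\,\mathfrak{g}^{-\theta_1}\subset\mathfrak{g}_{\mathbb{C}}.$$ The map $\Psi:\mathfrak{P}_c/{\equiv}\to\mathfrak{T}/{\equiv}$ is induced by $$(\mathfrak{g}_0,\sigma;\theta)\mapsto(\mathfrak{g},\ \theta|_{\mathfrak{g}},\ \sigma|_{\mathfrak{g}}),\qquad \mathfrak{g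}:=\mathfrak{g}_0^{\theta}+\sqrt{-1}\,\mathfrak{g}_0^{-\theta}\subset(\mathfrak{g}_0)_{\mathbb{C}}.$$
   Formalization: The set T is restricted to triads with θ1 ≠ id, because for θ1 = id the algebra g_0 = g is compact, so Φ would not take its value in P_c; θ2 = id and σ = id remain allowed. *)

(* Defs.v *)
From HB Require Import structures.
From mathcomp Require Import all_boot all_order all_algebra.
From mathcomp Require Import boolp reals.
From Corelib Require Import RelationClasses.

Set Implicit Arguments.
Unset Strict Implicit.
Unset Printing Implicit Defensive.

Import Order.TTheory GRing.Theory Num.Theory.
Local Open Scope ring_scope.

HB.mixin Record Vector_isLieAlgebra (K : fieldType) V of Vector K V := {
  lie : V -> V -> V;
  lie_linearl : forall y, linear (lie^~ y);
  lie_linearr : forall x, linear (lie x);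
  liexx : forall x, lie x x = 0;
  lie_jacobi : forall x y z,
    lie x (lie y z) + lie y (lie z x) + lie z (lie x y) = 0
}.

#[short(type="lieAlgType")]
HB.structure Definition LieAlgebra (K : fieldType) :=
  { V of Vector_isLieAlgebra K V & Vector K V }.

Section LieTheory.
Context {K : fieldType}.
Implicit Types g : lieAlgType K.

HB.instance Definition _ g (x : g) :=
  GRing.isSemilinear.Build K g g *:%R (lie x)
    (GRing.semilinear_linear (@lie_linearr K g x)).

Lemma lieDl g (x y z : g) : lie (x + y) z = lie x z + lie y z.
Proof. by have := lie_linearl z 1 x y; rewrite !scale1r. Qed.

Lemma lie0l g (z : g) : lie 0 z = 0.
Proof. by apply: (addrI (lie 0 z)); rewrite -lieDl !addr0. Qed.

Lemma lieZl g a (x z : g) : lie (a *: x) z = a *: lie x z.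
Proof. by have := lie_linearl z a x 0; rewrite !addr0 lie0l addr0. Qed.

Lemma lieNl g (x z : g) : lie (- x) z = - lie x z.
Proof. by rewrite -scaleN1r lieZl scaleN1r. Qed.

Lemma lieDr g (x y z : g) : lie x (y + z) = lie x y + lie x z.
Proof. exact: linearD. Qed.

Lemma lieNr g (x z : g) : lie x (- z) = - lie x z.
Proof. exact: linearN. Qed.

Lemma lieC g (x y : g) : lie x y = - lie y x.
Proof.
apply/eqP; rewrite -addr_eq0; apply/eqP.
by have := liexx (x + y); rewrite lieDl !linearD /= !liexx add0r addr0.
Qed.

Lemma lie_jacobil g (x y z : g) :
  lie (lie x y) z = lie x (lie y z) - lie y (lie x z).
Proof.
have /eqP := lie_jacobi x y z; rewrite addr_eq0 => /eqP.
rewrite (lieC z x) (lieC z (lie x y)) opprK lieNr => <-.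
by [].
Qed.

Definition ad g (x : g) : 'End(g) := linfun (lie x).

Lemma adE g (x y : g) : ad x y = lie x y.
Proof. by rewrite lfunE. Qed.

Definition lie_hom g g' (f : 'Hom(g, g')) : Prop :=
  forall x y, f (lie x y) = lie (f x) (f y).

Definition lie_iso g g' (f : 'Hom(g, g')) : Prop := bijective f /\ lie_hom f.

Record involution g := Involution {
  inv_fun :> 'End(g);
  inv_hom : lie_hom inv_fun;
  invK : forall x, inv_fun (inv_fun x) = x
}.

Definition lfun_trace (V : vectType K) (f : 'End(V)) : K :=
  \sum_i coord (vbasis {:V}) i (f (vbasis {:V})`_i).

Definition killing g (x y : g) : K := lfun_trace (ad x \o ad y)%VF.

(* Non-degeneracy of the Killing form is the definition of semisimplicity used
   in Helgason's book. *)
Definition semisimple g : Prop :=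
  forall x : g, (forall y, killing x y = 0) -> x = 0.

Section Trace.
Implicit Types V W : vectType K.

Lemma trace_exchange V W n m (e : n.-tuple V) (b : m.-tuple W)
    (f : 'Hom(V, W)) (h : 'Hom(W, V)) :
  basis_of {:V} e -> basis_of {:W} b ->
  \sum_i coord e i (h (f e`_i)) = \sum_j coord b j (f (h b`_j)).
Proof.
move=> eB bB.
have bE (w : W) : w = \sum_j coord b j w *: b`_j by exact: (coord_basis bB (memvf w)).
have eE (v : V) : v = \sum_i coord e i v *: e`_i by exact: (coord_basis eB (memvf v)).
transitivity (\sum_(i < n) \sum_(j < m) coord b j (f e`_i) * coord e i (h b`_j)).
  apply: eq_bigr => i _; rewrite {1}[f _]bE !linear_sum /=.
  by apply: eq_bigr => j _; rewrite !linearZ.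
rewrite exchange_big; apply: eq_bigr => j _ /=.
rewrite [in RHS](eE (h _)) !linear_sum /=.
by apply: eq_bigr => i _; rewrite !linearZ mulrC.
Qed.

Lemma trace_basis V n (e : n.-tuple V) (f : 'End(V)) :
  basis_of {:V} e -> lfun_trace f = \sum_i coord e i (f e`_i).
Proof.
move=> eB; have := trace_exchange f \1%VF eB (vbasisP {:V}).
under eq_bigr do rewrite lfunE /=.
by under [in RHS]eq_bigr do rewrite lfunE /=.
Qed.

Lemma traceC V W (f : 'Hom(V, W)) (h : 'Hom(W, V)) :
  lfun_trace (h \o f)%VF = lfun_trace (f \o h)%VF.
Proof.
rewrite /lfun_trace; under eq_bigr do rewrite comp_lfunE.
under [RHS]eq_bigr do rewrite comp_lfunE.
exact: trace_exchange (vbasisP _) (vbasisP _).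
Qed.

Lemma traceD V (f h : 'End(V)) :
  lfun_trace (f + h)%R = lfun_trace f + lfun_trace h.
Proof.
by rewrite -big_split; apply: eq_bigr => i _; rewrite lfunE /= linearD.
Qed.

Lemma traceN V (f : 'End(V)) : lfun_trace (- f)%R = - lfun_trace f.
Proof.
by rewrite -sumrN; apply: eq_bigr => i _; rewrite lfunE /= linearN.
Qed.

Lemma traceZ V a (f : 'End(V)) : lfun_trace (a *: f)%R = a * lfun_trace f.
Proof.
by rewrite mulr_sumr; apply: eq_bigr => i _; rewrite lfunE /= linearZ.
Qed.

End Trace.

Section Killing.
Context {g : lieAlgType K}.
Implicit Types x y z : g.

Lemma killingC x y : killing x y = killing y x.
Proof. exact: traceC. Qed.

Lemma adD x y : ad (x + y) = (ad x + ad y)%R.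
Proof. by apply/lfunP => z; rewrite add_lfunE !adE lieDl. Qed.

Lemma adZ a x : ad (a *: x) = (a *: ad x)%R.
Proof. by apply/lfunP => z; rewrite scale_lfunE !adE lieZl. Qed.

Lemma ad_lie x y : ad (lie x y) = ((ad x \o ad y)%VF - (ad y \o ad x)%VF)%R.
Proof.
apply/lfunP => z; rewrite add_lfunE opp_lfunE !comp_lfunE !adE.
exact: lie_jacobil.
Qed.

Lemma killingDl x y z : killing (x + y) z = killing x z + killing y z.
Proof. by rewrite /killing adD comp_lfunDl traceD. Qed.

Lemma killingZl a x z : killing (a *: x) z = a * killing x z.
Proof. by rewrite /killing adZ -comp_lfunZl traceZ. Qed.

Lemma killingNl x z : killing (- x) z = - killing x z.
Proof. by rewrite -scaleN1r killingZl mulN1r. Qed.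

Lemma killing0l z : killing 0 z = 0.
Proof. by rewrite -(scale0r 0) killingZl mul0r. Qed.

Lemma killingDr x y z : killing z (x + y) = killing z x + killing z y.
Proof. by rewrite !(killingC z) killingDl. Qed.

Lemma killingZr a x z : killing z (a *: x) = a * killing z x.
Proof. by rewrite !(killingC z) killingZl. Qed.

Lemma killingNr x z : killing z (- x) = - killing z x.
Proof. by rewrite !(killingC z) killingNl. Qed.

Lemma killing_lie x y z : killing (lie z x) y = - killing x (lie z y).
Proof.
rewrite /killing !ad_lie comp_lfunDl comp_lfunDr !traceD.
rewrite comp_lfunNl comp_lfunNr !traceN opprB.
rewrite -!comp_lfunA (traceC _ (ad z)) -comp_lfunA.
by [].
Qed.

End Killing.

End LieTheory.

Section RealLie.
Context {R : realType}.
Implicit Types g : lieAlgType R.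

Record inner_product (V : vectType R) := InnerProduct {
  ip_fun :> V -> V -> R;
  ip_linear : forall x a y z, ip_fun (a *: y + z) x = a * ip_fun y x + ip_fun z x;
  ip_sym : forall x y, ip_fun x y = ip_fun y x;
  ip_gt0 : forall x, x != 0 -> 0 < ip_fun x x
}.

(* Over the reals, a Lie algebra is that of a compact Lie group iff it has an
   invariant inner product; for a semisimple one this also says that the adjoint
   group is compact, or that the Killing form is negative definite. *)
Definition compact g : Prop :=
  exists q : inner_product g,
    forall z x y, q (lie z x) y = - q x (lie z y).

Definition cartan_involution g (theta : involution g) : Prop :=
  forall x, x != 0 -> 0 < - killing x (theta x).

Section InnerProduct.
Context {V : vectType R} (q : inner_product V).

Lemma ip_additive (x y z : V) : q (x + y) z = q x z + q y z.
Proof. by have := ip_linear q z 1 x y; rewrite scale1r mul1r. Qed.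

Lemma ip0l (z : V) : q 0 z = 0.
Proof. by apply: (addrI (q 0 z)); rewrite -ip_additive !addr0. Qed.

Lemma ipZl a (x z : V) : q (a *: x) z = a * q x z.
Proof. by have := ip_linear q z a x 0; rewrite !addr0 ip0l addr0. Qed.

Lemma ipr_linear (x : V) : linear (q x : V -> R^o).
Proof. by move=> a y z; rewrite !(ip_sym q x) ip_linear. Qed.

HB.instance Definition _ (x : V) :=
  GRing.isSemilinear.Build R V R^o *:%R (q x : V -> R^o)
    (GRing.semilinear_linear (ipr_linear x)).

Lemma ipZr a (x y : V) : q x (a *: y) = a * q x y.
Proof. by rewrite !(ip_sym q x) ipZl. Qed.

Lemma ip_sumr (x : V) n (F : 'I_n -> V) :
  q x (\sum_i F i) = \sum_i q x (F i).
Proof. exact: (linear_sum (q x : V -> R^o)). Qed.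

Lemma orthonormal_basis_sub n (U : {vspace V}) : \dim U = n ->
  exists e : n.-tuple V, basis_of U e /\
    forall i j : 'I_n, q e`_i e`_j = (i == j)%:R.
Proof.
elim: n U => [|n IH] U dU.
  exists [tuple]; split; last by case.
  by rewrite basisEfree nil_free span_nil sub0v dU.
have U0 : U != 0%VS by rewrite -dimv_eq0 dU.
pose x := vpick U.
have x0 : x != 0 by rewrite vpick0.
have xU : x \in U := memv_pick U.
have qx : 0 < q x x := ip_gt0 q x0.
pose phi : 'Hom(V, R^o) := linfun (q x : V -> R^o).
have phiE y : phi y = q x y by rewrite lfunE.
have dU' : \dim (U :&: lker phi) = n.
  have := limg_ker_dim phi U.
  have -> : \dim (phi @: U) = 1%N.
    apply/eqP; rewrite eqn_leq; apply/andP; split.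
      by apply: leq_trans (dimvS (subvf _)) _; rewrite dimvf.
    rewrite lt0n dimv_eq0; apply/negP => /eqP h.
    have := memv_img phi xU; rewrite h memv0 phiE => /eqP h'.
    by rewrite h' ltxx in qx.
  by rewrite dU addn1 => -[].
have [e [eB eq]] := IH _ dU'.
pose s := (Num.sqrt (q x x))^-1.
have ss : s * (s * q x x) = 1.
  rewrite /s mulrA -invfM -expr2 sqr_sqrtr ?(ltW qx) // mulVf //.
  by rewrite gt_eqF.
pose x' := s *: x.
have s0 : s != 0.
  by apply/eqP => h; move: ss; rewrite h mul0r => /eqP; rewrite eq_sym oner_eq0.
have x'e (i : 'I_n) : q x' e`_i = 0.
  have := basis_mem eB (mem_nth 0 (_ : (i < size e)%N)).
  rewrite size_tuple ltn_ord => /(_ isT); rewrite memv_cap => /andP[_].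
  by rewrite memv_ker phiE => /eqP h; rewrite ipZl h mulr0.
have x'U : x' \in U by apply: memvZ.
exists [tuple of x' :: e].
have ort : forall i j : 'I_n.+1, q (x' :: e)`_i (x' :: e)`_j = (i == j)%:R.
  move=> i j.
  case: (unliftP ord0 i) => [i'|] ->; case: (unliftP ord0 j) => [j'|] -> /=.
  - by rewrite eq (inj_eq (@lift_inj _ _)).
  - by rewrite ip_sym x'e.
  - by rewrite x'e.
  - by rewrite ipZl ip_sym ipZl ss.
split=> //.
rewrite basisEfree; apply/and3P; split.
- apply/freeP => k k0 i.
  have : q (x' :: e)`_i (\sum_(j < n.+1) k j *: (x' :: e)`_j) = 0.
    by rewrite [X in q _ X]k0 ip_sym ip0l.
  rewrite ip_sumr /=.
  rewrite (bigD1 i) //= [X in _ + X]big1 => [|j /negPf ji]; last first.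
    by rewrite ipZr ort eq_sym ji mulr0.
  by rewrite addr0 ipZr ort eqxx mulr1.
- apply/span_subvP => y; rewrite inE => /orP[/eqP -> //|ye].
  by have := basis_mem eB ye; rewrite memv_cap => /andP[].
- by rewrite dU size_tuple.
Qed.

Lemma orthonormal_basis : exists e : (\dim {:V}).-tuple V,
  basis_of {:V} e /\ forall i j : 'I_(\dim {:V}), q e`_i e`_j = (i == j)%:R.
Proof.
have [e [eB eo]] := orthonormal_basis_sub (erefl (\dim {:V})).
by exists e.
Qed.

Lemma trace_orthonormal n (e : n.-tuple V) (f : 'End(V)) :
  basis_of {:V} e -> (forall i j : 'I_n, q e`_i e`_j = (i == j)%:R) ->
  lfun_trace f = \sum_(i < n) q e`_i (f e`_i).
Proof.
move=> eB eo; rewrite (trace_basis _ eB); apply: eq_bigr => i _.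
rewrite [in RHS](coord_basis eB (memvf (f _))) ip_sumr (bigD1 i) //=.
rewrite ipZr eo eqxx mulr1 big1 ?addr0 // => j /negPf ji.
by rewrite ipZr eo eq_sym ji mulr0.
Qed.

End InnerProduct.

Lemma compact_killing_le0 g (x : g) : compact g -> killing x x <= 0.
Proof.
move=> [q qinv]; have [e [eB eo]] := orthonormal_basis q.
rewrite /killing (trace_orthonormal _ eB eo) -oppr_ge0 -sumrN.
apply: sumr_ge0 => i _; rewrite comp_lfunE !adE -qinv.
have [->|/(ip_gt0 q)/ltW //] := eqVneq (lie x e`_i) 0.
by rewrite ip0l.
Qed.

Lemma compact_killing_lt0 g (x : g) :
  compact g -> semisimple g -> x != 0 -> killing x x < 0.
Proof.
move=> gc gss x0; rewrite lt_neqAle compact_killing_le0 // andbT.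
apply/eqP => kxx; case/eqP: x0; apply: gss => y.
have [q qinv] := gc; have [e [eB eo]] := orthonormal_basis q.
have ge0 z : 0 <= q z z.
  have [->|/(ip_gt0 q)/ltW //] := eqVneq z 0; by rewrite ip0l.
suff ax : ad x = 0 by rewrite /killing ax comp_lfun0l /lfun_trace big1 // => i _; rewrite zero_lfunE linear0.
move: kxx => /eqP.
rewrite /killing (trace_orthonormal _ eB eo) -oppr_eq0 -sumrN.
rewrite psumr_eq0 => [/allP h|i _]; last by rewrite comp_lfunE !adE -qinv.
apply/lfunP => z; rewrite (coord_basis eB (memvf z)) !linear_sum; apply: eq_bigr => i _.
rewrite !linearZ /= zero_lfunE; congr (_ *: _).
apply/eqP; apply: contraT => xi0.
have := ip_gt0 q xi0; rewrite adE.
have := h i (mem_index_enum i).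
by rewrite comp_lfunE !adE -qinv => /eqP ->; rewrite ltxx.
Qed.

Lemma negdef_compact g : (forall x : g, x != 0 -> killing x x < 0) -> compact g.
Proof.
move=> neg.
have h1 (x : g) a (y z : g) :
    - killing (a *: y + z) x = a * - killing y x + - killing z x.
  by rewrite killingDl killingZl opprD mulrN.
have h2 (x y : g) : - killing x y = - killing y x by rewrite killingC.
have h3 (x : g) : x != 0 -> 0 < - killing x x by rewrite oppr_gt0; apply: neg.
by exists (InnerProduct h1 h2 h3) => z x y /=; rewrite killing_lie.
Qed.

Lemma negdef_semisimple g :
  (forall x : g, x != 0 -> killing x x < 0) -> semisimple g.
Proof.
move=> neg x x0; apply/eqP; apply: contraT => /neg.
by rewrite x0 ltxx.
Qed.

Lemma cartan_semisimple g (theta : involution g) :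
  cartan_involution theta -> semisimple g.
Proof.
move=> neg x x0; apply/eqP; apply: contraT => /neg.
by rewrite x0 oppr0 ltxx.
Qed.

End RealLie.

Section Complexification.
Context {R : realType} (g : lieAlgType R).

(* The real Lie algebra underlying the complexification of [g]:
   the pair [(x, y)] stands for [x + sqrt(-1) y]. *)
Definition complexification : Type := (g * g)%type.

HB.instance Definition _ := Vector.copy complexification (g * g)%type.

Implicit Types z w : complexification.

Definition cplx_lie z w : complexification :=
  (lie z.1 w.1 - lie z.2 w.2, lie z.1 w.2 + lie z.2 w.1).

Lemma cplx_lie_linearr z : linear (cplx_lie z).
Proof.
move=> a w w'; congr pair; rewrite /= !linearP /= scalerDr.
  by rewrite addrACA.
by rewrite addrACA.
Qed.

Lemma cplx_lieC z w : cplx_lie z w = - cplx_lie w z.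
Proof.
congr pair; rewrite /=; first by rewrite (lieC z.1) (lieC z.2) opprB opprK addrC.
by rewrite (lieC z.1) (lieC z.2) opprD addrC.
Qed.

Lemma cplx_lie_linearl w : linear (cplx_lie^~ w).
Proof.
move=> a z z'; rewrite /= !(cplx_lieC _ w) cplx_lie_linearr.
by rewrite opprD scalerN.
Qed.

Lemma cplx_liexx z : cplx_lie z z = 0.
Proof.
congr pair; rewrite /=; first by rewrite !liexx subr0.
by rewrite (lieC z.1) addNr.
Qed.

Lemma cplx_lie_jacobi x y z :
  cplx_lie x (cplx_lie y z) + cplx_lie y (cplx_lie z x)
    + cplx_lie z (cplx_lie x y) = 0.
Proof.
have add1 (u v : complexification) : (u + v).1 = u.1 + v.1 by [].
have add2 (u v : complexification) : (u + v).2 = u.2 + v.2 by [].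
congr pair; rewrite ?add1 ?add2 /= !(lieDr, lieNr) ?opprD.
  rewrite [LHS](AC ((2*2)*(2*2)*(2*2))
    ((1*5*9)*(2*8*11)*(3*6*12)*(4*7*10))) /= -!opprD !lie_jacobi.
  by rewrite !subr0.
rewrite [LHS](AC ((2*2)*(2*2)*(2*2))
  ((1*6*11)*(2*7*9)*(3*5*10)*(4*8*12))) /= -!opprD !lie_jacobi.
by rewrite !addr0 subr0.
Qed.

HB.instance Definition _ := Vector_isLieAlgebra.Build R complexification
  cplx_lie_linearl cplx_lie_linearr cplx_liexx cplx_lie_jacobi.

Definition cplx_embed_fun (x : g) : complexification := (x, 0).
Definition mul_sqrtN1_fun z : complexification := (- z.2, z.1).

Fact cplx_embed_linear : linear cplx_embed_fun.
Proof. by move=> a x y; congr pair; apply/esym/(etrans (addr0 _))/scaler0. Qed.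

Fact mul_sqrtN1_linear : linear mul_sqrtN1_fun.
Proof. by move=> a x y; congr pair; rewrite /= [LHS]opprD -scalerN. Qed.

HB.instance Definition _ := GRing.isSemilinear.Build R g complexification _
  cplx_embed_fun (GRing.semilinear_linear cplx_embed_linear).
HB.instance Definition _ :=
  GRing.isSemilinear.Build R complexification complexification _
    mul_sqrtN1_fun (GRing.semilinear_linear mul_sqrtN1_linear).

Definition cplx_embed : 'Hom(g, complexification) := linfun cplx_embed_fun.
Definition mul_sqrtN1 : 'End(complexification) := linfun mul_sqrtN1_fun.

Lemma cplx_embedE x : cplx_embed x = (x, 0).
Proof. by rewrite lfunE. Qed.

Lemma mul_sqrtN1E z : mul_sqrtN1 z = (- z.2, z.1).
Proof. by rewrite lfunE. Qed.

Lemma mul_sqrtN1K z : mul_sqrtN1 (mul_sqrtN1 z) = - z.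
Proof. by rewrite !mul_sqrtN1E. Qed.

Lemma lie_mul_sqrtN1l z w : lie (mul_sqrtN1 z) w = mul_sqrtN1 (lie z w).
Proof.
rewrite !mul_sqrtN1E; congr pair; rewrite /= !lieNl; last by rewrite addrC.
by rewrite opprD addrC.
Qed.

End Complexification.

Section ComplexificationMap.
Context {R : realType} {g g' : lieAlgType R}.

Definition cplx_extend_fun (f : 'Hom(g, g')) (z : complexification g) :
  complexification g' := (f z.1, f z.2).

Fact cplx_extend_linear f : linear (cplx_extend_fun f).
Proof. by move=> a x y; congr pair; apply: linearP. Qed.

HB.instance Definition _ f :=
  GRing.isSemilinear.Build R (complexification g) (complexification g') _
    (cplx_extend_fun f) (GRing.semilinear_linear (cplx_extend_linear f)).

(* The C-linear extension of [f]. *)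
Definition cplx_extend (f : 'Hom(g, g')) :
    'Hom(complexification g, complexification g') :=
  linfun (cplx_extend_fun f).

Lemma cplx_extendE f z : cplx_extend f z = (f z.1, f z.2).
Proof. by rewrite lfunE. Qed.

Lemma cplx_extend_hom f : lie_hom f -> lie_hom (cplx_extend f).
Proof.
move=> fh x y; rewrite !cplx_extendE.
by congr pair; rewrite /= ?linearB ?linearD /= !fh.
Qed.

Lemma cplx_extend_embed f x : cplx_extend f (cplx_embed g x) = cplx_embed g' (f x).
Proof. by rewrite cplx_extendE !cplx_embedE /= linear0. Qed.

Lemma cplx_extend_sqrtN1 f z :
  cplx_extend f (mul_sqrtN1 g z) = mul_sqrtN1 g' (cplx_extend f z).
Proof. by rewrite !mul_sqrtN1E !cplx_extendE /= linearN. Qed.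

End ComplexificationMap.

Arguments cplx_embed {R g}.
Arguments mul_sqrtN1 {R g}.

Section Dual.
Context {R : realType} {g : lieAlgType R}.
Variable nu : involution g.

Definition dual_space : {vspace complexification g} :=
  (cplx_embed @: passmx.leigenspace nu 1
   + mul_sqrtN1 @: (cplx_embed @: passmx.leigenspace nu (-1)))%VS.

Lemma leigenspaceP a x : reflect (nu x = a *: x) (x \in passmx.leigenspace nu a).
Proof.
rewrite memv_ker add_lfunE opp_lfunE scale_lfunE id_lfunE subr_eq0.
exact: eqP.
Qed.

Lemma dual_spaceP z :
  reflect (nu z.1 = z.1 /\ nu z.2 = - z.2) (z \in dual_space).
Proof.
apply: (iffP memv_addP) => [[u uE [v vE ->]]|[h1 h2]].
  have [x /leigenspaceP xE ->] := memv_imgP uE.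
  have [_ /memv_imgP[y /leigenspaceP yE ->] ->] := memv_imgP vE.
  rewrite !cplx_embedE mul_sqrtN1E /= oppr0 addr0 add0r.
  by rewrite xE yE scale1r scaleN1r.
exists (cplx_embed z.1).
  by apply/memv_img/leigenspaceP; rewrite scale1r.
exists (mul_sqrtN1 (cplx_embed z.2)).
  by do 2!apply/memv_img; apply/leigenspaceP; rewrite scaleN1r.
rewrite !cplx_embedE mul_sqrtN1E; case: z {h1 h2} => x y; congr pair => /=.
  by rewrite oppr0 addr0.
by rewrite add0r.
Qed.

Definition dual : Type := subvs_of dual_space.

HB.instance Definition _ := Vector.copy dual (subvs_of dual_space).

Definition dual_lie (z w : dual) : dual :=
  vsproj dual_space (lie (vsval z) (vsval w)).

Lemma dual_lieE z w : vsval (dual_lie z w) = lie (vsval z) (vsval w).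
Proof.
rewrite vsprojK //.
have /dual_spaceP[z1 z2] := subvsP z; have /dual_spaceP[w1 w2] := subvsP w.
apply/dual_spaceP; split=> /=.
  by rewrite linearB /= !inv_hom z1 z2 w1 w2 lieNl lieNr opprK.
by rewrite linearD /= !inv_hom z1 z2 w1 w2 lieNl lieNr -opprD.
Qed.

Lemma vsval_linear a (z w : dual) :
  vsval (a *: z + w) = a *: vsval z + vsval w.
Proof. exact: linearP. Qed.

Lemma dual_lie_linearl w : linear (dual_lie^~ w).
Proof.
move=> a z z'; apply: subvs_inj.
by rewrite dual_lieE !vsval_linear !dual_lieE; apply: lie_linearl.
Qed.

Lemma dual_lie_linearr z : linear (dual_lie z).
Proof.
move=> a w w'; apply: subvs_inj.
by rewrite dual_lieE !vsval_linear !dual_lieE; apply: lie_linearr.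
Qed.

Lemma dual_liexx z : dual_lie z z = 0.
Proof. by apply: subvs_inj; rewrite dual_lieE liexx. Qed.

Lemma dual_lie_jacobi x y z :
  dual_lie x (dual_lie y z) + dual_lie y (dual_lie z x)
    + dual_lie z (dual_lie x y) = 0.
Proof.
by apply: subvs_inj; rewrite !linearD /= !dual_lieE lie_jacobi.
Qed.

HB.instance Definition _ := Vector_isLieAlgebra.Build R dual
  dual_lie_linearl dual_lie_linearr dual_liexx dual_lie_jacobi.

Lemma dual_val_lie (z w : dual) : vsval (lie z w) = lie (vsval z) (vsval w).
Proof. exact: dual_lieE. Qed.

Lemma dual1 (z : dual) : nu (vsval z).1 = (vsval z).1.
Proof. by have /dual_spaceP[] := subvsP z. Qed.

Lemma dual2 (z : dual) : nu (vsval z).2 = - (vsval z).2.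
Proof. by have /dual_spaceP[] := subvsP z. Qed.

Lemma dual_eq0 (z : dual) : (vsval z).1 = 0 -> (vsval z).2 = 0 -> z = 0.
Proof. by move=> z1 z2; apply: subvs_inj; case: (vsval z) z1 z2 => /= ? ? -> ->. Qed.

End Dual.

Section DualMap.
Context {R : realType} {g g' : lieAlgType R}.
Variables (nu : involution g) (nu' : involution g') (f : 'Hom(g, g')).

(* The restriction to the dual algebras of the C-linear extension of [f]; it is
   meant for [f] intertwining [nu] and [nu']. *)
Definition dual_restrict : 'Hom(dual nu, dual nu') :=
  linfun (vsproj (dual_space nu') \o cplx_extend f \o vsval).

Hypothesis fnu : forall x, f (nu x) = nu' (f x).

Lemma dual_restrictE z : vsval (dual_restrict z) = cplx_extend f (vsval z).
Proof.
rewrite lfunE /= vsprojK // cplx_extendE; apply/dual_spaceP.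
by rewrite /= -!fnu dual1 dual2 linearN.
Qed.

Lemma dual_restrict_hom : lie_hom f -> lie_hom dual_restrict.
Proof.
move=> fh z w; apply: subvs_inj.
by rewrite dual_val_lie !dual_restrictE dual_val_lie cplx_extend_hom.
Qed.

Lemma dual_restrict_iso : lie_iso f -> lie_iso dual_restrict.
Proof.
move=> [[h fK hK] fh]; split; last exact: dual_restrict_hom.
have hE x : cplx_extend f (h x.1, h x.2) = x.
  by rewrite cplx_extendE /= !hK; case: x.
have hD (w : dual nu') : (h (vsval w).1, h (vsval w).2) \in dual_space nu.
  apply/dual_spaceP; split; apply: (can_inj fK); rewrite /= ?linearN /= fnu !hK.
    exact: dual1.
  exact: dual2.
exists (fun w : dual nu' =>
  vsproj (dual_space nu) (h (vsval w).1, h (vsval w).2)) => z; apply: subvs_inj.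
  rewrite vsprojK ?hD // dual_restrictE cplx_extendE /= !fK.
  by case: (vsval z).
by rewrite dual_restrictE vsprojK ?hD.
Qed.

End DualMap.

Section DualInvolution.
Context {R : realType} {g : lieAlgType R}.
Variables (nu sigma : involution g).
Hypothesis comm : forall x, sigma (nu x) = nu (sigma x).

Lemma dual_restrictK (z : dual nu) :
  dual_restrict nu nu sigma (dual_restrict nu nu sigma z) = z.
Proof.
apply: subvs_inj; rewrite !dual_restrictE // !cplx_extendE /= !invK.
by case: (vsval z).
Qed.

Definition dual_involution : involution (dual nu) :=
  Involution (dual_restrict_hom comm (@inv_hom _ _ sigma)) dual_restrictK.

Lemma dual_involutionE z :
  vsval (dual_involution z) = (sigma (vsval z).1, sigma (vsval z).2).
Proof. by rewrite dual_restrictE // cplx_extendE. Qed.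

End DualInvolution.

Section DualKilling.
Context {R : realType} {g : lieAlgType R}.
Variable nu : involution g.

Definition to_dual_fun (x : g) : dual nu :=
  vsproj (dual_space nu) (2^-1 *: (x + nu x), 2^-1 *: (x - nu x)).

Lemma to_dualE x : vsval (to_dual_fun x) = (2^-1 *: (x + nu x), 2^-1 *: (x - nu x)).
Proof.
rewrite vsprojK //; apply/dual_spaceP; rewrite /= !linearZ /= linearD linearB /= invK.
by split; [rewrite addrC | rewrite opprB].
Qed.

Definition of_dual_fun (z : dual nu) : g := (vsval z).1 + (vsval z).2.

Lemma to_dual_linear : linear to_dual_fun.
Proof.
move=> a x y; apply: subvs_inj; rewrite vsval_linear !to_dualE.
congr pair; rewrite /= linearP /=.
  by rewrite addrACA [LHS]scalerDr -[X in _ *: X + _]scalerDr !scalerA mulrC.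
by rewrite opprD addrACA [LHS]scalerDr -[X in _ *: X + _]scalerBr !scalerA mulrC.
Qed.

Lemma of_dual_linear : linear of_dual_fun.
Proof.
by move=> a z w; rewrite /of_dual_fun vsval_linear /= scalerDr addrACA.
Qed.

HB.instance Definition _ := GRing.isSemilinear.Build R g (dual nu) _
  to_dual_fun (GRing.semilinear_linear to_dual_linear).
HB.instance Definition _ := GRing.isSemilinear.Build R (dual nu) g _
  of_dual_fun (GRing.semilinear_linear of_dual_linear).

Definition to_dual : 'Hom(g, dual nu) := linfun to_dual_fun.
Definition of_dual : 'Hom(dual nu, g) := linfun of_dual_fun.

Lemma half_scale (x : g) : 2^-1 *: (x + x) = x.
Proof. by rewrite -mulr2n -scaler_nat scalerA mulVf ?scale1r ?pnatr_eq0. Qed.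

Lemma to_dualK : (of_dual \o to_dual)%VF = \1%VF.
Proof.
apply/lfunP => x; rewrite comp_lfunE id_lfunE !lfunE /= /of_dual_fun to_dualE /=.
rewrite -scalerDr addrACA subrr addr0.
exact: half_scale.
Qed.

Lemma of_dualK : (to_dual \o of_dual)%VF = \1%VF.
Proof.
apply/lfunP => z; rewrite comp_lfunE id_lfunE !lfunE /=; apply: subvs_inj.
have nuz : nu (of_dual_fun z) = (vsval z).1 - (vsval z).2.
  by rewrite linearD /= dual1 dual2.
rewrite to_dualE nuz /of_dual_fun.
rewrite [_ + _ + (_ - _)]addrACA subrr addr0 half_scale.
rewrite opprB [_ + _ + (_ - _)](AC (2*2) ((1*4)*(2*3))) /= subrr add0r half_scale.
by case: (vsval z).
Qed.

Lemma ad_dual (z : dual nu) :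
  (of_dual \o ad z \o to_dual)%VF =
  (ad (vsval z).1 + (ad (vsval z).2 \o nu)%VF)%R.
Proof.
apply/lfunP => x; rewrite !comp_lfunE add_lfunE comp_lfunE !adE.
rewrite [of_dual _]lfunE [to_dual _]lfunE /= /of_dual_fun dual_val_lie to_dualE.
rewrite /= addrACA -lieDr -scalerDr addrACA subrr addr0 half_scale; congr (_ + _).
rewrite addrC -lieNr -lieDr -scalerBr -[nu x in RHS]half_scale.
by rewrite opprB [x + nu x]addrC addrACA subrr addr0.
Qed.

Lemma nu_ad x : (nu \o ad x)%VF = (ad (nu x) \o nu)%VF.
Proof. by apply/lfunP => y; rewrite !comp_lfunE !adE inv_hom. Qed.

Lemma nuK : (nu \o nu)%VF = \1%VF.
Proof. by apply/lfunP => y; rewrite comp_lfunE id_lfunE invK. Qed.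

Lemma trace_nu (f : 'End(g)) : lfun_trace (nu \o f \o nu)%VF = lfun_trace f.
Proof. by rewrite traceC comp_lfunA nuK comp_lfun1l. Qed.

Lemma trace_eq0 (f : 'End(g)) : (nu \o f \o nu)%VF = (- f)%R -> lfun_trace f = 0.
Proof.
move=> h; have /eqP := trace_nu f; rewrite h traceN eq_sym -subr_eq0 opprK.
by rewrite -mulr2n mulrn_eq0 => /eqP.
Qed.

Lemma killing_dual (z w : dual nu) :
  killing z w = killing (vsval z).1 (vsval w).1 - killing (vsval z).2 (vsval w).2.
Proof.
have -> : killing z w = lfun_trace
    ((of_dual \o ad z \o to_dual) \o (of_dual \o ad w \o to_dual))%VF.
  rewrite -!comp_lfunA (comp_lfunA to_dual) of_dualK comp_lfun1l.
  by rewrite traceC -!comp_lfunA of_dualK comp_lfun1r.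
rewrite !ad_dual comp_lfunDl !comp_lfunDr !traceD.
have nua (x : dual nu) : (nu \o ad (vsval x).1)%VF = (ad (vsval x).1 \o nu)%VF.
  by rewrite nu_ad dual1.
have adN (x : g) : ad (- x) = (- ad x)%R by rewrite -scaleN1r adZ scaleN1r.
have nub (x : dual nu) : (nu \o ad (vsval x).2)%VF = (- (ad (vsval x).2 \o nu)%VF)%R.
  by rewrite nu_ad dual2 adN comp_lfunNl.
rewrite [X in _ + X + _]trace_eq0; last first.
  rewrite !comp_lfunA nua -!(comp_lfunA _ nu) nuK comp_lfun1r.
  by rewrite -comp_lfunA nub comp_lfunNr comp_lfunA.
rewrite addr0 [X in _ + (X + _)]trace_eq0; last first.
  rewrite -!comp_lfunA !(comp_lfunA nu (ad (vsval z).2)) nub !comp_lfunNl.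
  by rewrite -comp_lfunA (comp_lfunA nu nu) nuK comp_lfun1l nua.
rewrite add0r -[X in _ = _ + X]traceN; congr (_ + lfun_trace _).
by rewrite -comp_lfunA (comp_lfunA nu) nub comp_lfunNl comp_lfunNr -comp_lfunA nuK comp_lfun1r.
Qed.

End DualKilling.

Section Quotient.
Context {T : Type}.

(* The quotient of [T] by [r] as the set of its equivalence classes.  The
   quotients of [generic_quotient] need a [choiceType], which universe levels
   forbid here: the elements of [T] are themselves structures over types. *)
Record quotient (r : T -> T -> Prop) := Quotient {
  qclass : T -> Prop;
  qclassP : exists x, qclass = r x
}.

Definition class_of (r : T -> T -> Prop) (x : T) : quotient r :=
  Quotient (ex_intro _ x erefl).

Context {r : T -> T -> Prop} {rE : Equivalence r}.

Lemma class_ofP x y : class_of r x = class_of r y <-> r x y.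
Proof.
split=> [/(congr1 (@qclass _)) /= rxy|rxy].
  by rewrite rxy; apply: Equivalence_Reflexive.
have e : r x = r y.
  apply: funext => z; apply: propext; split=> h.
    by apply: Equivalence_Transitive h; apply: Equivalence_Symmetric.
  exact: Equivalence_Transitive h.
by rewrite /class_of; case: _ / e (ex_intro _ y _) => p; congr Quotient.
Qed.

Lemma class_of_surj (c : quotient r) : exists x, c = class_of r x.
Proof. by case: c => c [x e]; exists x; subst c. Qed.

End Quotient.

Section QuotientMap.
Context {T T' : Type} {r : T -> T -> Prop} {r' : T' -> T' -> Prop}.
Context {rE : Equivalence r} {rE' : Equivalence r'}.
Variables (f : T -> T') (fr : forall x y, r x y -> r' (f x) (f y)).

Fact quotient_map_subproof (c : quotient r) :
  exists y, (fun z => exists2 x, qclass c x & r' (f x) z) = r' y.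
Proof.
case: c => c [x e] /=; subst c; exists (f x); apply: funext => z; apply: propext.
split=> [[y rxy rz]|rz]; last by exists x => //; apply: Equivalence_Reflexive.
by apply: Equivalence_Transitive rz; apply: fr.
Qed.

(* No representative is chosen: the image of a class is the saturation of the
   set of the images of its elements; see [quotient_mapE]. *)
Definition quotient_map (c : quotient r) : quotient r' :=
  Quotient (quotient_map_subproof c).

Lemma quotient_mapE x : quotient_map (class_of r x) = class_of r' (f x).
Proof.
have e : (fun z => exists2 y, r x y & r' (f y) z) = r' (f x).
  apply: funext => z; apply: propext.
  split=> [[y rxy rz]|rz]; last by exists x => //; apply: Equivalence_Reflexive.
  by apply: Equivalence_Transitive rz; apply: fr.
rewrite /quotient_map /class_of /=; move: (quotient_map_subproof _) => /=.
by rewrite e => p; congr Quotient.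
Qed.

End QuotientMap.

Section Isomorphisms.
Context {K : fieldType}.
Implicit Types g : lieAlgType K.

Lemma lie_iso_id g : lie_iso (\1%VF : 'End(g)).
Proof.
split; first by exists id => x; rewrite id_lfunE.
by move=> x y; rewrite !id_lfunE.
Qed.

Lemma lie_iso_comp g1 g2 g3 (f : 'Hom(g1, g2)) (h : 'Hom(g2, g3)) :
  lie_iso f -> lie_iso h -> lie_iso (h \o f)%VF.
Proof.
move=> [fb fh] [hb hh]; split; last by move=> x y; rewrite !comp_lfunE fh hh.
by apply: (eq_bij (bij_comp hb fb)) => x /=; rewrite comp_lfunE.
Qed.

Lemma lie_iso_inv g g' (f : 'Hom(g, g')) : lie_iso f ->
  exists h : 'Hom(g', g), [/\ lie_iso h, cancel f h & cancel h f].
Proof.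
move=> [[h fK hK] fh].
have hP : linear h.
  by move=> a x y; apply: (can_inj fK); rewrite hK linearP /= !hK.
pose hL := GRing.isSemilinear.Build K g' g _ h (GRing.semilinear_linear hP).
pose H : {linear g' -> g} := HB.pack h hL.
have HE x : linfun H x = h x by rewrite lfunE.
exists (linfun H); split=> [|x|x]; rewrite ?HE //.
split; first by exists f => x; rewrite HE.
by move=> x y; apply: (can_inj fK); rewrite !HE fh !hK.
Qed.

End Isomorphisms.

Section Main.
Context {R : realType}.

Record symmetric_pair := SymmetricPair {
  pair_alg :> lieAlgType R;
  pair_semisimple : semisimple pair_alg;
  pair_noncompact : ~ compact pair_alg;
  pair_sigma : involution pair_alg
}.

Record cartan_pair := CartanPair {
  cartan_pair_pair :> symmetric_pair;
  cartan_theta : involution cartan_pair_pair;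
  cartan_thetaP : cartan_involution cartan_theta;
  cartan_comm : forall x,
    cartan_theta (pair_sigma cartan_pair_pair x) =
    pair_sigma cartan_pair_pair (cartan_theta x)
}.

(* The identity is an involution as far as [involution] is concerned.  The
   algebra g^theta1 + sqrt(-1) g^(-theta1) is then equal to the compact algebra
   g when theta1 is the identity, so this one case has to be excluded for it to
   be non-compact.  There is no such restriction on theta2. *)
Record symmetric_triad := SymmetricTriad {
  triad_alg :> lieAlgType R;
  triad_compact : compact triad_alg;
  triad_semisimple : semisimple triad_alg;
  triad_theta1 : involution triad_alg;
  triad_theta2 : involution triad_alg;
  triad_comm : forall x,
    triad_theta1 (triad_theta2 x) = triad_theta2 (triad_theta1 x);
  triad_theta1_neq1 : inv_fun triad_theta1 <> \1%VF
}.

Definition intertwines (g g' : lieAlgType R) (phi : 'Hom(g, g'))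
    (nu : involution g) (nu' : involution g') : Prop :=
  forall x, phi (nu x) = nu' (phi x).

Definition pair_equiv (p p' : symmetric_pair) : Prop :=
  exists2 phi : 'Hom(p, p'), lie_iso phi &
    intertwines phi (pair_sigma p) (pair_sigma p').

Definition cartan_equiv (p p' : cartan_pair) : Prop :=
  exists phi : 'Hom(p, p'), [/\ lie_iso phi,
    intertwines phi (pair_sigma p) (pair_sigma p') &
    intertwines phi (cartan_theta p) (cartan_theta p')].

Definition triad_equiv (t t' : symmetric_triad) : Prop :=
  exists psi : 'Hom(t, t'), [/\ lie_iso psi,
    intertwines psi (triad_theta1 t) (triad_theta1 t') &
    intertwines psi (triad_theta2 t) (triad_theta2 t')].

Lemma intertwines_id (g : lieAlgType R) (nu : involution g) :
  intertwines \1%VF nu nu.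
Proof. by move=> x; rewrite !id_lfunE. Qed.

Lemma intertwines_comp (g1 g2 g3 : lieAlgType R) (f : 'Hom(g1, g2))
    (h : 'Hom(g2, g3)) nu1 nu2 nu3 :
  intertwines f nu1 nu2 -> intertwines h nu2 nu3 ->
  intertwines (h \o f)%VF nu1 nu3.
Proof. by move=> i1 i2 x; rewrite !comp_lfunE i1 i2. Qed.

Lemma intertwines_inv (g g' : lieAlgType R) (f : 'Hom(g, g'))
    (h : 'Hom(g', g)) nu nu' :
  cancel f h -> cancel h f -> intertwines f nu nu' -> intertwines h nu' nu.
Proof. by move=> fK hK i x; apply: (can_inj fK); rewrite i !hK. Qed.

#[export] Instance pair_equivE : Equivalence pair_equiv.
Proof.
split=> [p|p p' [f fi fs]|p1 p2 p3 [f fi fs] [h hi hs]].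
- by exists \1%VF; [exact: lie_iso_id | exact: intertwines_id].
- have [h [hi fK hK]] := lie_iso_inv fi.
  by exists h => //; apply: intertwines_inv fs.
- exists (h \o f)%VF; first exact: lie_iso_comp.
  exact: intertwines_comp fs hs.
Qed.

#[export] Instance cartan_equivE : Equivalence cartan_equiv.
Proof.
split=> [p|p p' [f [fi fs ft]]|p1 p2 p3 [f [fi fs ft]] [h [hi hs ht]]].
- exists \1%VF; split; [exact: lie_iso_id | exact: intertwines_id
    | exact: intertwines_id].
- have [h [hi fK hK]] := lie_iso_inv fi.
  by exists h; split=> //; [apply: intertwines_inv fs|apply: intertwines_inv ft].
- exists (h \o f)%VF; split; first exact: lie_iso_comp.
    exact: intertwines_comp fs hs.
  exact: intertwines_comp ft ht.
Qed.

#[export] Instance triad_equivE : Equivalence triad_equiv.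
Proof.
split=> [p|p p' [f [fi fs ft]]|p1 p2 p3 [f [fi fs ft]] [h [hi hs ht]]].
- exists \1%VF; split; [exact: lie_iso_id | exact: intertwines_id
    | exact: intertwines_id].
- have [h [hi fK hK]] := lie_iso_inv fi.
  by exists h; split=> //; [apply: intertwines_inv fs|apply: intertwines_inv ft].
- exists (h \o f)%VF; split; first exact: lie_iso_comp.
    exact: intertwines_comp fs hs.
  exact: intertwines_comp ft ht.
Qed.

Fact forget_cartan_equiv (p p' : cartan_pair) :
  cartan_equiv p p' -> pair_equiv p p'.
Proof. by move=> [f [fi fs _]]; exists f. Qed.

Definition ptilde : quotient cartan_equiv -> quotient pair_equiv :=
  quotient_map forget_cartan_equiv.

Section PhiTriad.
Variable t : symmetric_triad.
Let theta1 := triad_theta1 t.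

Definition Phi_theta : involution (dual theta1) :=
  dual_involution (fun x => erefl (theta1 (theta1 x))).

Definition Phi_sigma : involution (dual theta1) :=
  dual_involution (fun x => esym (triad_comm x)).

Lemma dual_neq0 (z : dual theta1) :
  z != 0 -> (vsval z).1 != 0 \/ (vsval z).2 != 0.
Proof.
move=> z0; case: (eqVneq (vsval z).1 0) => [z1|]; last by left.
case: (eqVneq (vsval z).2 0) => [z2|]; last by right.
by rewrite (dual_eq0 z1 z2) eqxx in z0.
Qed.

Fact Phi_cartan : cartan_involution Phi_theta.
Proof.
move=> z z0; rewrite killing_dual dual_involutionE /= dual1 dual2 killingNr opprK.
have lt0 := compact_killing_lt0 (triad_compact t) (@triad_semisimple t).
have le0 x := compact_killing_le0 x (triad_compact t).
rewrite oppr_gt0; case: (dual_neq0 z0) => h.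
  by rewrite -[ltRHS]addr0 ltr_leD // lt0.
by rewrite -[ltRHS]addr0 ler_ltD // lt0.
Qed.

Fact Phi_noncompact : ~ compact (dual theta1).
Proof.
move=> c; apply: (@triad_theta1_neq1 t); apply/lfunP => x; rewrite id_lfunE.
apply/eqP; rewrite eq_sym -subr_eq0; apply: contraT => y0.
pose y := x - theta1 x.
have yE : (0, y) \in dual_space theta1.
  by apply/dual_spaceP; rewrite /= linear0 linearB /= invK opprB.
have := compact_killing_le0 (vsproj (dual_space theta1) (0, y) : dual theta1) c.
rewrite killing_dual vsprojK //= killing0l add0r oppr_le0 leNgt.
by rewrite (compact_killing_lt0 (triad_compact t) (@triad_semisimple t)).
Qed.

Fact Phi_comm z : Phi_theta (Phi_sigma z) = Phi_sigma (Phi_theta z).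
Proof.
by apply: subvs_inj; rewrite !dual_involutionE /= !triad_comm.
Qed.

Definition Phi_triad : cartan_pair :=
  @CartanPair
    (SymmetricPair (cartan_semisimple Phi_cartan) Phi_noncompact Phi_sigma)
    Phi_theta Phi_cartan Phi_comm.

End PhiTriad.

Fact dual_restrict_intertwines (g g' : lieAlgType R) (f : 'Hom(g, g'))
    (nu sigma : involution g) (nu' sigma' : involution g')
    (c : forall x, sigma (nu x) = nu (sigma x))
    (c' : forall x, sigma' (nu' x) = nu' (sigma' x)) :
  intertwines f nu nu' -> intertwines f sigma sigma' ->
  intertwines (dual_restrict nu nu' f) (dual_involution c) (dual_involution c').
Proof.
move=> i1 i2 z; apply: subvs_inj.
by rewrite dual_restrictE // !dual_involutionE dual_restrictE // !cplx_extendE /= !i2.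
Qed.

Fact Phi_equiv (t t' : symmetric_triad) :
  triad_equiv t t' -> cartan_equiv (Phi_triad t) (Phi_triad t').
Proof.
move=> [f [fi f1 f2]].
exists (dual_restrict (triad_theta1 t) (triad_theta1 t') f); split.
- exact: dual_restrict_iso.
- exact: dual_restrict_intertwines.
- exact: dual_restrict_intertwines.
Qed.

Definition Phi : quotient triad_equiv -> quotient cartan_equiv :=
  quotient_map Phi_equiv.

Section PsiPair.
Variable p : cartan_pair.
Let theta := cartan_theta p.

Definition Psi_theta1 : involution (dual theta) :=
  dual_involution (fun x => erefl (theta (theta x))).

Definition Psi_theta2 : involution (dual theta) :=
  dual_involution (fun x => esym (cartan_comm x)).

Fact Psi_negdef (z : dual theta) : z != 0 -> killing z z < 0.
Proof.
have lt0 := @cartan_thetaP p.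
have ge0 x : 0 <= - killing x (theta x).
  have [->|/lt0/ltW //] := eqVneq x 0; by rewrite killing0l oppr0.
move=> z0; rewrite killing_dual -oppr_gt0 opprB.
have -> : killing (vsval z).1 (vsval z).1 = killing (vsval z).1 (theta (vsval z).1).
  by rewrite dual1.
have -> : killing (vsval z).2 (vsval z).2 = - killing (vsval z).2 (theta (vsval z).2).
  by rewrite dual2 killingNr opprK.
case: (eqVneq (vsval z).1 0) => [z1|z1]; last by rewrite ltr_wpDl // lt0.
case: (eqVneq (vsval z).2 0) => [z2|z2]; last by rewrite ltr_wpDr // lt0.
by rewrite (dual_eq0 z1 z2) eqxx in z0.
Qed.

Fact Psi_comm z : Psi_theta1 (Psi_theta2 z) = Psi_theta2 (Psi_theta1 z).
Proof.
by apply: subvs_inj; rewrite !dual_involutionE /= !cartan_comm.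
Qed.

Fact Psi_theta1_neq1 : inv_fun Psi_theta1 <> \1%VF.
Proof.
move=> e; apply: (@pair_noncompact p); apply: negdef_compact => x x0.
suff tx : theta x = x.
  by rewrite -{2}tx -oppr_gt0 cartan_thetaP.
apply/eqP; rewrite eq_sym -subr_eq0; apply/eqP.
pose y := x - theta x.
have yE : (0, y) \in dual_space theta.
  by apply/dual_spaceP; rewrite /= linear0 linearB /= invK opprB.
have : vsval (Psi_theta1 (vsproj (dual_space theta) (0, y) : dual theta)) = (0, y).
  by rewrite e id_lfunE vsprojK.
rewrite dual_involutionE vsprojK //= => -[_ ye].
have y2 : y + y = 0 by rewrite -{2}ye linearB /= invK /y addrC subrKA subrr.
by rewrite -[LHS]half_scale -/y y2 scaler0.
Qed.

Definition Psi_pair : symmetric_triad :=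
  SymmetricTriad (negdef_compact Psi_negdef) (negdef_semisimple Psi_negdef)
    Psi_comm Psi_theta1_neq1.

End PsiPair.

Fact Psi_equiv (p p' : cartan_pair) :
  cartan_equiv p p' -> triad_equiv (Psi_pair p) (Psi_pair p').
Proof.
move=> [f [fi fs ft]].
exists (dual_restrict (cartan_theta p) (cartan_theta p') f); split.
- exact: dual_restrict_iso.
- exact: dual_restrict_intertwines.
- exact: dual_restrict_intertwines.
Qed.

Definition Psi : quotient cartan_equiv -> quotient triad_equiv :=
  quotient_map Psi_equiv.

End Main.

Arguments symmetric_pair R : clear implicits.
Arguments cartan_pair R : clear implicits.
Arguments symmetric_triad R : clear implicits.
Arguments ptilde R : clear implicits.
Arguments Phi R : clear implicits.
Arguments Psi R : clear implicits.

(* Main.v *)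
From HB Require Import structures.
Require Import Defs.
From mathcomp Require Import all_boot all_order all_algebra.
From mathcomp Require Import boolp classical_sets reals.
From mathcomp Require Import topology normedtype sequences derive exp.
From mathcomp Require Import ring lra.

(** The duality attached to an involution nu of g replaces g by
    g^nu + i g^(-nu).  Doing it twice puts g^nu + i i g^(-nu) into an iterated
    complexification, which is a copy of g again, compatibly with every
    involution that commutes with nu ([undual_iso], [undual_intertwines]).
    Hence Phi and Psi are inverse to each other, and what remains is the
    bijectivity of ptilde: on a semisimple g with an involution sigma, a Cartan
    involution that commutes with sigma exists, and it is unique up to an
    automorphism that commutes with sigma.

    Uniqueness comes from square roots.  If theta and theta' are Cartan
    involutions, then theta theta' is an automorphism which is symmetric and
    positive for the inner product - B (x, theta y).  Its positive square root
    phi multiplies each eigenspace by the square root of the eigenvalue; as the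
    bracket multiplies eigenvalues, phi is an automorphism as well, and
    phi theta' = theta phi ([cartan_sqrt]).  If sigma commutes with theta and
    theta' then it commutes with phi ([cartan_conjugate]).  If instead
    theta' = sigma theta sigma, then theta phi is a Cartan involution that
    commutes with sigma ([cartan_commuting]), so that it is enough to find any
    Cartan involution of g.

    It is found by minimising the norm of the bracket, following Richardson and
    Donaldson.  Fix an inner product, and consider the Lie brackets on the
    vector space g that are isomorphic to the given one and have the same
    Killing form B.  These form a closed set: a limit of them is a Lie bracket
    whose Killing form B is still nondegenerate, and such a bracket is rigid,
    that is, isomorphic to all Lie brackets close enough to it ([rigidity]).
    Rigidity is the vanishing of the second cohomology group with adjoint
    coefficients.  The Casimir element provides an explicit contracting homotopy
    ([cochain_homotopy]); with it, a step of Newton's method for the equation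
    h (c (x, y)) = [h x, h y] in h makes the error quadratically small
    ([newton_step]).  The existence of a solution then follows from compactness:
    a suitable functional has a minimum near the identity, and a step of
    Newton's method would decrease it further if the error were not zero there.

    So the sum of the squares of the structure constants attains its minimum
    on this set of brackets ([minimal_bracket]).  At a minimum, the derivative in
    the direction of an endomorphism S that is symmetric for the inner product
    and skew for B must vanish ([minimal_critical]).  For D = ad x and
    S = [D, D^T], where D^T is the transpose of D, this derivative is the
    squared norm of the action of D^T on the bracket, because D itself acts by
    zero.  Hence D^T is a derivation, so it is inner, and
    ad (tau x) = - (ad x)^T defines a Cartan involution tau
    ([minimal_cartan]). *)

Set Implicit Arguments.
Unset Strict Implicit.
Unset Printing Implicit Defensive.

Import Order.TTheory GRing.Theory Num.Theory numFieldNormedType.Exports.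
Local Open Scope ring_scope.

(** * Linear maps and the Killing form *)

Section LinHom.
Context {K : fieldType} {V W : vectType K} {f : V -> W}.
Hypothesis fL : linear f.

Definition lin_hom : 'Hom(V, W) :=
  let fl := GRing.isSemilinear.Build K V W _ f (GRing.semilinear_linear fL) in
  let F : {linear V -> W} := HB.pack f fl in linfun F.

Lemma lin_homE x : lin_hom x = f x.
Proof. by rewrite lfunE. Qed.

End LinHom.

Section KillingIso.
Context {K : fieldType} {g g' : lieAlgType K}.

Lemma killing_iso (f : 'Hom(g, g')) x y :
  lie_iso f -> killing (f x) (f y) = killing x y.
Proof.
move=> fi; have [h [_ fK hK]] := lie_iso_inv fi; have [_ fh] := fi.
have -> : killing (f x) (f y) = lfun_trace (f \o (ad x \o (ad y \o h)))%VF.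
  congr lfun_trace; apply/lfunP => z.
  by rewrite !comp_lfunE !adE !fh hK.
rewrite traceC; congr lfun_trace; apply/lfunP => z.
by rewrite !comp_lfunE !adE fK.
Qed.

End KillingIso.

(** * The dual of the dual *)

Section DoubleDual.
Context {R : realType} {g : lieAlgType R}.
Variable nu : involution g.

Definition dual_nu : involution (dual nu) :=
  dual_involution (fun x => erefl (nu (nu x))).

(** An element of the double dual is a quadruple of vectors of [g].  Two of them
    lie both in the 1- and in the (-1)-eigenspace of [nu], so they vanish. *)
Lemma dual_dual_eqs (z : dual dual_nu) :
  [/\ nu (vsval (vsval z).1).1 = (vsval (vsval z).1).1,
      (vsval (vsval z).1).2 = 0,
      (vsval (vsval z).2).1 = 0 &
      nu (vsval (vsval z).2).2 = - (vsval (vsval z).2).2].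
Proof.
have self0 (x : g) : x = - x -> x = 0.
  move/eqP; rewrite -subr_eq0 opprK => /eqP h.
  by rewrite -[x]half_scale h scaler0.
have e1 := congr1 vsval (dual1 z); have e2 := congr1 vsval (dual2 z).
rewrite !dual_involutionE in e1 e2.
split; rewrite ?dual1 ?dual2 //; apply: self0.
  by rewrite -{2}e1 /= dual2 opprK.
have /= e21 := congr1 fst e2.
by rewrite -[LHS]dual1 e21.
Qed.

(** The copy of g^(-nu) in the double dual is i i g^(-nu) = - g^(-nu).  Replacing
    the factor i i by 1 amounts to composing the identification with [nu], which
    is an automorphism, so no sign has to be inserted here. *)
Definition undual_fun (z : dual dual_nu) : g :=
  (vsval (vsval z).1).1 + (vsval (vsval z).2).2.

Lemma undual_linear : linear undual_fun.
Proof. by move=> a z w; rewrite /undual_fun !vsval_linear /= scalerDr addrACA. Qed.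

Definition undual : 'Hom(dual dual_nu, g) := lin_hom undual_linear.

Lemma undualE z : undual z = (vsval (vsval z).1).1 + (vsval (vsval z).2).2.
Proof. exact: lin_homE. Qed.

Lemma undual_iso : lie_iso undual.
Proof.
split.
  pose up (x : g) : dual nu := vsproj (dual_space nu) (2^-1 *: (x + nu x), 0).
  pose um (x : g) : dual nu := vsproj (dual_space nu) (0, 2^-1 *: (x - nu x)).
  have upE x : vsval (up x) = (2^-1 *: (x + nu x), 0).
    rewrite vsprojK //; apply/dual_spaceP; rewrite /= linear0 oppr0 linearZ /=.
    by rewrite linearD /= invK addrC.
  have umE x : vsval (um x) = (0, 2^-1 *: (x - nu x)).
    rewrite vsprojK //; apply/dual_spaceP; rewrite /= linear0 linearZ /=.
    by rewrite linearB /= invK -scalerN opprB.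
  have mem x : (up x, um x) \in dual_space dual_nu.
    apply/dual_spaceP; split; apply: subvs_inj; rewrite dual_involutionE /=.
      by rewrite upE /= linear0 linearZ /= linearD /= invK addrC.
    rewrite umE /= linear0 linearZ /= linearB /= invK.
    by congr pair; rewrite /= ?oppr0 // -scalerN opprB.
  exists (fun x => vsproj (dual_space dual_nu) (up x, um x) : dual dual_nu).
    move=> z; have [e1 e2 e3 e4] := dual_dual_eqs z.
    have nuz : nu ((vsval (vsval z).1).1 + (vsval (vsval z).2).2) =
        (vsval (vsval z).1).1 - (vsval (vsval z).2).2.
      by rewrite -e4 -[in RHS]e1; apply: linearD.
    apply: subvs_inj; rewrite vsprojK // undualE.
    rewrite [RHS]surjective_pairing; congr pair; apply: subvs_inj.
      rewrite upE nuz addrACA subrr addr0 half_scale.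
      by rewrite [RHS]surjective_pairing e2.
    rewrite umE nuz opprD opprK addrACA subrr add0r half_scale.
    by rewrite [RHS]surjective_pairing e3.
  move=> x; rewrite undualE vsprojK // upE umE /=.
  by rewrite -scalerDr addrACA subrr addr0 half_scale.
move=> z w; have [z1 z2 z3 z4] := dual_dual_eqs z.
have [w1 w2 w3 w4] := dual_dual_eqs w.
rewrite !undualE dual_val_lie /= !dual_val_lie /= z2 z3 w2 w3.
rewrite !lie0l !linear0 lieDl !lieDr !addr0 !add0r opprK.
by rewrite [LHS](AC (2*2) ((1*3)*(4*2))).
Qed.

Lemma undual_intertwines (sigma : involution g)
    (c : forall x, sigma (nu x) = nu (sigma x))
    (c' : forall z, dual_involution c (dual_nu z) = dual_nu (dual_involution c z)) :
  intertwines undual (dual_involution c') sigma.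
Proof.
move=> z; rewrite !undualE dual_involutionE /= !dual_involutionE //=.
by rewrite linearD.
Qed.

End DoubleDual.

(** * Continuity and compactness in finite dimension *)

Section PolynomialContinuity.
Local Open Scope classical_set_scope.
Context {R : realType} {T : topologicalType}.
Implicit Types f g : T -> R.

Lemma cont_cst (a : R) : continuous (fun _ : T => a).
Proof. exact: cst_continuous. Qed.

Lemma cont_add f g : continuous f -> continuous g ->
  continuous (fun x => f x + g x).
Proof. by move=> fc gc x; apply: continuousD; [apply: fc | apply: gc]. Qed.

Lemma cont_sub f g : continuous f -> continuous g ->
  continuous (fun x => f x - g x).
Proof. by move=> fc gc x; apply: continuousB; [apply: fc | apply: gc]. Qed.

Lemma cont_mul f g : continuous f -> continuous g ->
  continuous (fun x => f x * g x).
Proof. by move=> fc gc x; apply: continuousM; [apply: fc | apply: gc]. Qed.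

Lemma cont_sqr f : continuous f -> continuous (fun x => f x ^+ 2).
Proof. by move=> fc; apply: (cont_mul fc fc). Qed.

Lemma cont_norm f : continuous f -> continuous (fun x => `|f x|).
Proof. by move=> fc x; apply: continuous_comp (fc x) (@norm_continuous _ _ _). Qed.

Lemma cont_sum (J : Type) (r : seq J) (P : pred J) (F : J -> T -> R) :
  (forall j, continuous (F j)) -> continuous (fun x => \sum_(j <- r | P j) F j x).
Proof.
move=> Fc; elim: r => [|j r IH].
  under eq_fun do rewrite big_nil; exact: cont_cst.
under eq_fun do rewrite big_cons; case: (P j) => //; exact: cont_add.
Qed.

Lemma closed_eq_cst f (a : R) : continuous f -> closed [set x | f x = a].
Proof.
by move=> fc; apply: (preimage_closed (D := [set y | y = a])) (@closed_eq _ a).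
Qed.

Lemma closed_le_cst f (a : R) : continuous f -> closed [set x | f x <= a].
Proof.
by move=> fc; apply: (preimage_closed (D := [set y | y <= a])) (@closed_le _ a).
Qed.

End PolynomialContinuity.

Section FiniteDimCompact.
Local Open Scope classical_set_scope.
Context {R : realType} {I : eqType}.
Notation X := {ptws I -> R}.

Lemma cont_coord (i : I) : continuous (fun x : X => x i).
Proof. exact: (@proj_continuous I (fun=> R) i). Qed.

(** Coordinates of vectors, of endomorphisms and of brackets are all handled as
    functions on a finite index type with the product topology, where closed
    bounded sets are compact by Tychonoff's theorem. *)
Lemma bounded_closed_min (f : X -> R) (A : set X) (M : R) (x0 : X) :
  continuous f -> closed A -> (forall x i, A x -> `|x i| <= M) -> A x0 ->
  exists2 x, A x & forall y, A y -> f x <= f y.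
Proof.
move=> fc Acl AM Ax0.
have Bc : compact [set x : X | forall i, `[- M, M] (x i)].
  exact: (@tychonoff I (fun=> R) (fun=> `[- M, M]) (fun=> @segment_compact R _ _)).
have Ac : compact A.
  apply: subclosed_compact Acl Bc _ => x Ax i /=.
  by rewrite in_itv /= -ler_norml AM.
have [||x /set_mem Ax xmin] := compact_EVT_min _ Ac (f := f).
- by exists x0.
- exact: continuous_subspaceT.
by exists x => // y Ay; apply: xmin; apply: mem_set.
Qed.

End FiniteDimCompact.

(** * The spectral theorem *)

Section InnerProductTheory.
Context {R : realType} {V : vectType R} (q : inner_product V).

Lemma ipDr (x y z : V) : q x (y + z) = q x y + q x z.
Proof. by rewrite !(ip_sym q x) ip_additive. Qed.

Lemma ipNl (x y : V) : q (- x) y = - q x y.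
Proof. by rewrite -scaleN1r ipZl mulN1r. Qed.

Lemma ipNr (x y : V) : q x (- y) = - q x y.
Proof. by rewrite !(ip_sym q x) ipNl. Qed.

Lemma ip0r (x : V) : q x 0 = 0.
Proof. by rewrite ip_sym ip0l. Qed.

Lemma ip_ge0 (x : V) : 0 <= q x x.
Proof. by have [->|/(ip_gt0 q)/ltW //] := eqVneq x 0; rewrite ip0l. Qed.

Lemma ip_eq0 (x : V) : q x x = 0 -> x = 0.
Proof. by move=> q0; apply: contra_eq q0 => /(ip_gt0 q); rewrite lt0r => /andP[]. Qed.

Lemma ip_suml (x : V) n (F : 'I_n -> V) : q (\sum_i F i) x = \sum_i q (F i) x.
Proof. by rewrite ip_sym ip_sumr; apply: eq_bigr => i _; rewrite ip_sym. Qed.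

Definition orthonormal n (e : n.-tuple V) : Prop :=
  forall i j : 'I_n, q e`_i e`_j = (i == j)%:R.

Lemma orthonormal_basis_of n (e : n.-tuple V) (U : {vspace V}) :
  orthonormal e -> \dim U = n -> (forall i : 'I_n, e`_i \in U) -> basis_of U e.
Proof.
move=> eo dU eU; rewrite basisEfree; apply/and3P; split.
- apply/freeP => k k0 i.
  have : q e`_i (\sum_(j < n) k j *: e`_j) = 0 by rewrite [X in q _ X]k0 ip0r.
  rewrite ip_sumr (bigD1 i) //= big1 => [|j /negPf ji]; last first.
    by rewrite ipZr eo eq_sym ji mulr0.
  by rewrite addr0 ipZr eo eqxx mulr1.
- apply/span_subvP => y /(nthP 0)[j]; rewrite size_tuple => jn <-.
  exact: (eU (Ordinal jn)).
- by rewrite dU size_tuple.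
Qed.

Section Expansion.
Context {n : nat} {e : n.-tuple V} {U : {vspace V}}.
Hypotheses (eB : basis_of U e) (eo : orthonormal e).

Lemma ip_coord (x : V) (i : 'I_n) : x \in U -> coord e i x = q e`_i x.
Proof.
move=> xU; rewrite {2}(coord_basis eB xU) ip_sumr (bigD1 i) //= big1 => [|j /negPf ji].
  by rewrite addr0 ipZr eo eqxx mulr1.
by rewrite ipZr eo eq_sym ji mulr0.
Qed.

Lemma ip_expand (x : V) : x \in U -> x = \sum_(i < n) q e`_i x *: e`_i.
Proof.
by move=> xU; rewrite {1}(coord_basis eB xU); apply: eq_bigr => i _; rewrite ip_coord.
Qed.

End Expansion.

Section Spectral.
Variable N : 'End(V).
Hypothesis Nsym : forall x y, q (N x) y = q x (N y).

(** A maximum [x] of the Rayleigh quotient on the unit sphere of [U] is an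
    eigenvector: [lam * q y y - q (N y) y] is a positive semidefinite form on
    [U] that vanishes at [x], so [x] is in its radical. *)
Lemma symmetric_eigenvector (U : {vspace V}) : (N @: U <= U)%VS -> U != 0%VS ->
  exists x lam, [/\ x \in U, q x x = 1 & N x = lam *: x].
Proof.
move=> NU U0.
have NUx x : x \in U -> N x \in U by move=> /(memv_img N)/(subvP NU).
have [e [eB eo]] := orthonormal_basis_sub q (erefl (\dim U)).
set n := \dim U in e eB eo.
pose vec (c : {ptws 'I_n -> R}) : V := \sum_(i < n) c i *: e`_i.
have eU (i : 'I_n) : e`_i \in U.
  by apply: (basis_mem eB); rewrite mem_nth ?size_tuple.
have vecU c : vec c \in U by apply: memv_suml => i _; apply: memvZ.
have vecK y : y \in U -> y = vec (fun i => q e`_i y) by exact: ip_expand.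
have qvec c : q (vec c) (vec c) = \sum_(i < n) c i ^+ 2.
  rewrite ip_suml; apply: eq_bigr => i _; rewrite ipZl ip_sumr (bigD1 i) //= big1.
    by rewrite ipZr eo eqxx mulr1 addr0 expr2.
  by move=> j /negPf ji; rewrite ipZr eo eq_sym ji mulr0.
pose f (c : {ptws 'I_n -> R}) : R := - q (N (vec c)) (vec c).
have fc : continuous f.
  have -> : f = fun c : {ptws 'I_n -> R} =>
      \sum_(i < n) \sum_(j < n) c i * c j * - q (N e`_i) e`_j.
    apply: funext => c; rewrite /f.
    have -> : N (vec c) = \sum_(i < n) c i *: N e`_i.
      by rewrite linear_sum; apply: eq_bigr => i _; rewrite linearZ.
    rewrite ip_suml -sumrN; apply: eq_bigr => i _; rewrite ip_sumr -sumrN.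
    by apply: eq_bigr => j _; rewrite ipZl ipZr; ring.
  do 2!(apply: cont_sum => ?); apply: cont_mul; last exact: cont_cst.
  by apply: cont_mul; apply: cont_coord.
have [z zU z0] : exists2 z, z \in U & z != 0.
  by exists (vpick U); rewrite ?memv_pick ?vpick0.
have unit y : y \in U -> y != 0 ->
    exists2 c, q (vec c) (vec c) = 1 & y = Num.sqrt (q y y) *: vec c.
  move=> yU y0; have qy := ip_gt0 q y0.
  have s0 : Num.sqrt (q y y) != 0 by rewrite gt_eqF // sqrtr_gt0.
  have yE : y = Num.sqrt (q y y) *: ((Num.sqrt (q y y))^-1 *: y).
    by rewrite scalerA mulfV // scale1r.
  exists (fun i => q e`_i ((Num.sqrt (q y y))^-1 *: y)); last by rewrite -vecK ?memvZ.
  rewrite -vecK ?memvZ // ipZl ipZr mulrA -invfM -expr2 sqr_sqrtr ?ltW //.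
  by rewrite mulVf // gt_eqF.
have [c0 c01 _] := unit z zU z0.
have [|d i dA||c c1 cmin] :=
    @bounded_closed_min R 'I_n f [set c | \sum_(i < n) c i ^+ 2 = 1] 1 c0 fc.
- apply: closed_eq_cst; apply: cont_sum => i.
  by apply: cont_sqr; apply: cont_coord.
- rewrite -(@ler_pXn2r _ 2) ?nnegrE // expr1n real_normK ?num_real // -dA.
  by rewrite (bigD1 i) //= lerDl sumr_ge0 // => j _; rewrite sqr_ge0.
- by rewrite /= -qvec.
pose x := vec c; pose lam := q (N x) x.
have qx : q x x = 1 by rewrite qvec.
have xU : x \in U := vecU c.
have max y : y \in U -> q (N y) y <= lam * q y y.
  move=> yU; have [->|y0] := eqVneq y 0; first by rewrite ip0r ip0l mulr0.
  have [d d1 ->] := unit y yU y0; set s := Num.sqrt _.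
  rewrite [N _]linearZ !(ipZl, ipZr) d1 mulr1.
  have /cmin : [set c | \sum_(i < n) c i ^+ 2 = 1]%classic d by rewrite /= -qvec.
  rewrite lerN2 => le; rewrite mulrA [leRHS]mulrC -expr2.
  by rewrite ler_wpM2l ?sqr_ge0.
(* The form is nonnegative at [x + t *: y] for all [t]. *)
have quad y t : y \in U ->
    0 <= 2 * t * q (lam *: x - N x) y + t ^+ 2 * (lam * q y y - q (N y) y).
  move=> yU; have := max _ (memvD xU (memvZ t yU)).
  have -> : N (x + t *: y) = N x + t *: N y by rewrite linearD linearZ.
  rewrite -subr_ge0.
  rewrite !(ip_additive, ipDr, ipZl, ipZr, ipNl).
  rewrite (ip_sym q y x) (Nsym y x) (ip_sym q y (N x)) -/lam qx.
  by congr (0 <= _); ring.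
have wU : lam *: x - N x \in U by rewrite memvB ?memvZ ?NUx.
suff w0 : lam *: x - N x = 0.
  by exists x, lam; split => //; apply/esym/eqP; rewrite -subr_eq0 w0.
move: wU; move: (_ - _) quad => w quad wU; apply: ip_eq0.
have := quad w _ wU.
set a := q w w; set b := _ - _ => {}quad.
have a0 : 0 <= a := ip_ge0 w.
have b1 : 0 < `|b| + 1 by rewrite ltr_wpDl.
(* Any small enough negative multiple of [a] contradicts the inequality. *)
have := quad (- a / (`|b| + 1)).
have bb : b <= `|b| + 1 by apply: le_trans (ler_norm b) _; rewrite lerDl.
move: b1 bb; move: (`|b| + 1) => d d0 bd.
have -> : 2 * (- a / d) * a + (- a / d) ^+ 2 * b = (a / d) ^+ 2 * (b - 2 * d).
  by field; rewrite gt_eqF.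
apply: contraTeq => a1; rewrite -ltNge nmulr_llt0; last by lra.
by rewrite exprn_gt0 // divr_gt0 // lt0r a1.
Qed.

Lemma spectral_sub n (U : {vspace V}) : \dim U = n -> (N @: U <= U)%VS ->
  exists (e : n.-tuple V) (lam : 'I_n -> R),
    [/\ orthonormal e, forall i : 'I_n, e`_i \in U &
        forall i : 'I_n, N e`_i = lam i *: e`_i].
Proof.
elim: n U => [|n IH] U dU NU; first by exists [tuple], (fun=> 0); split; case.
have U0 : U != 0%VS by rewrite -dimv_eq0 dU.
have [x [mu [xU qx Nx]]] := symmetric_eigenvector NU U0.
pose phi : 'Hom(V, R^o) := linfun (q x : V -> R^o).
have phiE y : phi y = q x y by rewrite lfunE.
have dU' : \dim (U :&: lker phi) = n.
  have := limg_ker_dim phi U.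
  have -> : \dim (phi @: U) = 1%N.
    apply/eqP; rewrite eqn_leq; apply/andP; split.
      by apply: leq_trans (dimvS (subvf _)) _; rewrite dimvf.
    rewrite lt0n dimv_eq0; apply/negP => /eqP h.
    have := memv_img phi xU; rewrite h memv0 phiE qx.
    by rewrite oner_eq0.
  by rewrite dU addn1 => -[].
have capP y : reflect (y \in U /\ q x y = 0) (y \in (U :&: lker phi)%VS).
  by rewrite memv_cap memv_ker phiE; apply: (iffP andP) => -[? /eqP ?].
have NU' : (N @: (U :&: lker phi) <= U :&: lker phi)%VS.
  apply/subvP => _ /memv_imgP[y /capP[yU xy] ->]; apply/capP.
  by rewrite (subvP NU) ?memv_img // -Nsym Nx ipZl xy mulr0.
have [e [lam [eo eU eN]]] := IH _ dU' NU'.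
exists [tuple of x :: e], (fun i => if unlift ord0 i is Some j then lam j else mu).
split=> [i j|i|i].
- case: (unliftP ord0 i) => [i'|] ->; case: (unliftP ord0 j) => [j'|] -> //=.
  + by rewrite eo (inj_eq (@lift_inj _ _)).
  + by rewrite ip_sym; have /capP[_ ->] := eU i'.
  + by have /capP[_ ->] := eU j'.
- by case: (unliftP ord0 i) => [i'|] -> //=; have /capP[] := eU i'.
- by case: (unliftP ord0 i) => [i'|] -> /=; rewrite ?liftK ?unlift_none ?eN.
Qed.

Theorem spectral : exists (e : (\dim {:V}).-tuple V) (lam : 'I_(\dim {:V}) -> R),
  [/\ basis_of {:V} e, orthonormal e & forall i : 'I_(\dim {:V}), N e`_i = lam i *: e`_i].
Proof.
have [e [lam [eo eU eN]]] := spectral_sub (erefl (\dim {:V})) (subvf _).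
by exists e, lam; split=> //; apply: orthonormal_basis_of => // i; apply: memvf.
Qed.

End Spectral.

Section Diagonal.
Context {n : nat} (e : n.-tuple V).
Hypothesis eB : basis_of {:V} e.

Fact diag_subproof (mu : 'I_n -> R) :
  linear (fun x : V => \sum_i (mu i * coord e i x) *: e`_i).
Proof.
move=> a x y; rewrite scaler_sumr -big_split; apply: eq_bigr => i _ /=.
by rewrite linearP mulrDr scalerDl scalerA mulrCA.
Qed.

Definition diag_lfun mu : 'End(V) := lin_hom (diag_subproof mu).

Lemma diag_lfunE mu (i : 'I_n) : diag_lfun mu e`_i = mu i *: e`_i.
Proof.
rewrite lin_homE (bigD1 i) //= coord_free ?(basis_free eB) // eqxx mulr1.
rewrite big1 ?addr0 // => j /negPf ji.
by rewrite coord_free ?(basis_free eB) // eq_sym ji mulr0 scale0r.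
Qed.

Lemma basis_ext (W : vectType R) (f h : 'Hom(V, W)) :
  (forall i : 'I_n, f e`_i = h e`_i) -> f = h.
Proof.
move=> fh; apply/lfunP => x; rewrite (coord_basis eB (memvf x)) !linear_sum.
by apply: eq_bigr => i _; rewrite !linearZ /= fh.
Qed.

End Diagonal.
End InnerProductTheory.

(** * Conjugacy of Cartan involutions *)

Section SquareRoot.
Context {R : realType} {V : vectType R} (q : inner_product V) (N : 'End(V)).
Hypothesis Nsym : forall x y, q (N x) y = q x (N y).
Hypothesis Npos : forall x, x != 0 -> 0 < q (N x) x.

(** The square root is characterised by its effect on all eigenvectors of [N],
    and not only on the chosen basis; this is the form in which one sees that it
    is compatible with every structure that permutes the eigenspaces. *)
Lemma positive_sqrt : exists (e : (\dim {:V}).-tuple V)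
    (lam : 'I_(\dim {:V}) -> R) (phi : 'End(V)),
  [/\ basis_of {:V} e, forall i : 'I_(\dim {:V}), 0 < lam i,
      forall i : 'I_(\dim {:V}), N e`_i = lam i *: e`_i,
      forall v mu, N v = mu *: v -> phi v = Num.sqrt mu *: v &
      forall x, x != 0 -> 0 < q (phi x) x].
Proof.
have [e [lam [eB eo eN]]] := spectral Nsym.
have lam_gt0 i : 0 < lam i.
  have e0 : e`_i != 0.
    by apply/eqP => e0; have := eo i i; rewrite e0 ip0l eqxx => /eqP; rewrite eq_sym oner_eq0.
  by have := Npos e0; rewrite eN ipZl eo eqxx mulr1.
exists e, lam, (diag_lfun e (fun i => Num.sqrt (lam i))); split=> //.
  move=> v mu Nv; rewrite lin_homE {2}(coord_basis eB (memvf v)) scaler_sumr.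
  apply: eq_bigr => i _; rewrite scalerA; congr (_ *: _).
  have : coord e i (N v) = mu * coord e i v by rewrite Nv linearZ.
  have NvE : N v = diag_lfun e lam v.
    by congr fun_of_lfun; apply: (basis_ext eB) => j; rewrite (diag_lfunE eB) eN.
  rewrite NvE lin_homE linear_sum (bigD1 i) //= big1 => [|j /negPf ji]; last first.
    by rewrite linearZ /= coord_free ?(basis_free eB) // ji mulr0.
  rewrite linearZ /= coord_free ?(basis_free eB) // eqxx mulr1 addr0.
  have [-> _|v0 /(mulIf v0) -> //] := eqVneq (coord e i v) 0.
  by rewrite !mulr0.
move=> x x0; rewrite lin_homE ip_suml.
have ge0 i : true -> 0 <= q ((Num.sqrt (lam i) * coord e i x) *: e`_i) x.
  move=> _; rewrite ipZl -(ip_coord eB eo) ?memvf // -mulrA -expr2.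
  by rewrite mulr_ge0 ?sqr_ge0 ?sqrtr_ge0.
rewrite lt0r sumr_ge0 // andbT psumr_neq0 //.
apply/negPn/negP => /hasPn h; case/eqP: x0.
rewrite (coord_basis eB (memvf x)) big1 // => i _.
have := h i (mem_index_enum i); rewrite /= -leNgt ipZl.
rewrite -(ip_coord eB eo) ?memvf // -mulrA -expr2 pmulr_rle0 ?sqrtr_gt0 //.
by rewrite real_exprn_even_le0 //= => /eqP ->; rewrite scale0r.
Qed.

End SquareRoot.

Section CartanSquareRoot.
Context {R : realType} {g : lieAlgType R}.
Implicit Types theta sigma : involution g.

Lemma involution_iso theta : lie_iso theta.
Proof. by split; [exists theta => x; rewrite invK | apply: inv_hom]. Qed.

Lemma killing_inv theta (x y : g) : killing (theta x) y = killing x (theta y).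
Proof. by rewrite -[in RHS](killing_iso _ _ (involution_iso theta)) invK. Qed.

Section CartanForm.
Variable theta : involution g.
Hypothesis thetaC : cartan_involution theta.

Fact cartan_form_linear (x : g) a (y z : g) :
  - killing (a *: y + z) (theta x) =
  a * - killing y (theta x) + - killing z (theta x).
Proof. by rewrite killingDl killingZl opprD mulrN. Qed.

Fact cartan_form_sym (x y : g) : - killing x (theta y) = - killing y (theta x).
Proof. by rewrite -killing_inv killingC. Qed.

Definition cartan_form : inner_product g :=
  InnerProduct cartan_form_linear cartan_form_sym thetaC.

End CartanForm.

(** The map [phi] is the positive square root of [N = theta theta'].  An
    endomorphism [T] that commutes with [N] preserves its eigenspaces and so
    commutes with [phi]; if [N T N = T], then [T] exchanges the eigenspaces for
    [mu] and for [mu^-1], so that [phi T phi = T].  Both [theta] and [theta'] are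
    of the second kind; the last conclusion records the two cases for a further
    involution [sigma]. *)
Lemma cartan_sqrt theta theta' :
  cartan_involution theta -> cartan_involution theta' ->
  exists phi : 'End(g), [/\ lie_iso phi,
    forall x, x != 0 -> 0 < - killing x (theta (phi x)),
    forall x, phi (theta' x) = theta (phi x),
    forall x, phi (theta (phi x)) = theta x &
    forall sigma,
      ((forall x, sigma (theta x) = theta (sigma x)) ->
       (forall x, sigma (theta' x) = theta' (sigma x)) ->
       forall x, phi (sigma x) = sigma (phi x)) /\
      ((forall x, sigma (theta x) = theta' (sigma x)) ->
       forall x, phi (sigma (phi x)) = sigma x)].
Proof.
move=> tC t'C; pose q := cartan_form tC.
pose N : 'End(g) := (theta \o theta')%VF.
have NE x : N x = theta (theta' x) by rewrite comp_lfunE.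
have qN x y : q (N x) y = - killing x (theta' y).
  by rewrite NE /= killing_inv invK killing_inv.
have Nsym x y : q (N x) y = q x (N y).
  by rewrite qN /= NE invK.
have Npos x : x != 0 -> 0 < q (N x) x by rewrite qN; apply: t'C.
have [e [lam [phi [eB lam_gt0 eN phiN phi_pos]]]] := positive_sqrt Nsym Npos.
have phie (i : 'I_(\dim {:g})) : phi e`_i = Num.sqrt (lam i) *: e`_i := phiN _ _ (eN i).
have commN (T : 'End(g)) : (forall x, N (T x) = T (N x)) ->
    forall x, phi (T x) = T (phi x).
  move=> TN x; have /lfunP/(_ x) : (phi \o T)%VF = (T \o phi)%VF.
    apply: (basis_ext eB) => i; rewrite !comp_lfunE phie linearZ; apply: phiN.
    by rewrite TN eN linearZ.
  by rewrite !comp_lfunE.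
have invN (T : 'End(g)) : (forall x, N (T (N x)) = T x) ->
    forall x, phi (T (phi x)) = T x.
  move=> TN x; have /lfunP/(_ x) : (phi \o (T \o phi))%VF = T.
    apply: (basis_ext eB) => i; rewrite !comp_lfunE phie !linearZ /=.
    rewrite (phiN _ (lam i)^-1).
      by rewrite scalerA -sqrtrM ?ltW // mulfV ?sqrtr1 ?scale1r // gt_eqF.
    by rewrite -[in RHS]TN eN !linearZ /= scalerA mulfV ?scale1r // gt_eqF.
  by rewrite !comp_lfunE.
have phi2 x : phi (phi x) = N x.
  have /lfunP/(_ x) : (phi \o phi)%VF = N; last by rewrite comp_lfunE.
  apply: (basis_ext eB) => i; rewrite comp_lfunE phie linearZ /= phie.
  by rewrite scalerA -expr2 sqr_sqrtr ?eN // ltW.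
have phit x : phi (theta (phi x)) = theta x.
  by apply: invN => y; rewrite !NE invK invK.
have phit' x : phi (theta' x) = theta (phi x).
  by rewrite -phit phi2 NE invK.
(* The bracket of eigenvectors for [lam i] and [lam j] is an eigenvector for
   [lam i * lam j], and square roots are multiplicative. *)
have phi_hom : lie_hom phi.
  have h (i : 'I_(\dim {:g})) y : phi (lie e`_i y) = lie (phi e`_i) (phi y).
    have /lfunP/(_ y) : (phi \o ad e`_i)%VF = (ad (phi e`_i) \o phi)%VF.
      apply: (basis_ext eB) => j; rewrite !comp_lfunE !adE !phie.
      rewrite lieZl linearZ /= scalerA -sqrtrM ?ltW //; apply: phiN.
      by rewrite NE inv_hom inv_hom -!NE !eN lieZl linearZ /= scalerA.
    by rewrite !comp_lfunE !adE.
  move=> x y; have /lfunP/(_ x) : (phi \o ad y)%VF = (ad (phi y) \o phi)%VF.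
    apply: (basis_ext eB) => i; rewrite !comp_lfunE !adE.
    by rewrite lieC linearN /= h -lieC.
  by rewrite !comp_lfunE !adE (lieC x) (lieC (phi x)) linearN => <-.
exists phi; split=> //.
- split=> //; exists (fun x => theta (phi (theta x))) => x; last first.
    by rewrite phit invK.
  by rewrite -[RHS](invK theta) -[theta x in RHS]phit -phit'.
- by move=> x x0; rewrite -cartan_form_sym; apply: phi_pos.
- move=> sigma; split=> [st st' x|st x].
    by apply: commN => y; rewrite !NE -st' -st.
  apply: invN => y; rewrite !NE -[in X in theta X]st.
  have st' z : sigma (theta' z) = theta (sigma z).
    by rewrite -[RHS](invK sigma) (st (sigma z)) invK.
  by rewrite invK st' invK.
Qed.

(** With [theta' = sigma theta sigma] and [phi] as in [cartan_sqrt], conjugating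
    [theta] half way towards [theta'], that is by the square root of [phi], gives
    [theta phi]; this formula avoids a second square root. *)
Lemma cartan_commuting theta sigma : cartan_involution theta ->
  exists2 theta' : involution g, cartan_involution theta' &
    forall x, theta' (sigma x) = sigma (theta' x).
Proof.
move=> tC.
have conj_hom : lie_hom (sigma \o (theta \o sigma))%VF.
  by move=> x y; rewrite !comp_lfunE !inv_hom.
have conjK x : (sigma \o (theta \o sigma))%VF ((sigma \o (theta \o sigma))%VF x) = x.
  by rewrite !comp_lfunE !invK.
pose theta1 := Involution conj_hom conjK.
have t1E x : theta1 x = sigma (theta (sigma x)) by rewrite !comp_lfunE.
have t1C : cartan_involution theta1.
  move=> x x0; rewrite t1E -killing_inv; apply: tC.
  by apply: contra_neq x0 => sx; rewrite -[x](invK sigma) sx linear0.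
have [phi [[_ phi_hom] phi_pos phit1 phit phis]] := cartan_sqrt tC t1C.
have {phis} [_ phis] := phis sigma.
have {}phis x : phi (sigma (phi x)) = sigma x.
  by apply: phis => y; rewrite t1E invK.
have new_hom : lie_hom (theta \o phi)%VF.
  by move=> x y; rewrite !comp_lfunE phi_hom inv_hom.
have newK x : (theta \o phi)%VF ((theta \o phi)%VF x) = x.
  by rewrite !comp_lfunE phit invK.
exists (Involution new_hom newK) => [x x0|x] /=.
  by rewrite comp_lfunE; apply: phi_pos.
rewrite !comp_lfunE -phit1 t1E invK.
by rewrite -[in LHS]phit phis.
Qed.

Lemma cartan_conjugate theta theta' sigma :
  cartan_involution theta -> cartan_involution theta' ->
  (forall x, theta (sigma x) = sigma (theta x)) ->
  (forall x, theta' (sigma x) = sigma (theta' x)) ->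
  exists phi : 'End(g), [/\ lie_iso phi,
    forall x, phi (sigma x) = sigma (phi x) &
    forall x, phi (theta' x) = theta (phi x)].
Proof.
move=> tC t'C ts t's; have [phi [phi_iso _ phit _ phis]] := cartan_sqrt tC t'C.
by exists phi; split=> //; apply: (phis sigma).1.
Qed.

End CartanSquareRoot.

(** * Bilinear maps and norms *)

Section Bilinear.
Context {K : fieldType} {V : vectType K} {W : lmodType K}.

Definition bilin (u : V -> V -> W) : Prop :=
  (forall y, linear (u^~ y)) /\ (forall x, linear (u x)).

Variable u : V -> V -> W.
Hypothesis ub : bilin u.

Let lin_l y : {linear V -> W} := HB.pack (u^~ y)
  (GRing.isSemilinear.Build K V W _ (u^~ y) (GRing.semilinear_linear (ub.1 y))).
Let lin_r x : {linear V -> W} := HB.pack (u x)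
  (GRing.isSemilinear.Build K V W _ (u x) (GRing.semilinear_linear (ub.2 x))).

Lemma bilDl x y z : u (x + y) z = u x z + u y z.
Proof. exact: (linearD (lin_l z)). Qed.
Lemma bilDr x y z : u x (y + z) = u x y + u x z.
Proof. exact: (linearD (lin_r x)). Qed.
Lemma bilZl a x z : u (a *: x) z = a *: u x z.
Proof. exact: (linearZ_LR (lin_l z)). Qed.
Lemma bilZr a x z : u x (a *: z) = a *: u x z.
Proof. exact: (linearZ_LR (lin_r x)). Qed.
Lemma bilNl x z : u (- x) z = - u x z.
Proof. exact: (linearN (lin_l z)). Qed.
Lemma bilNr x z : u x (- z) = - u x z.
Proof. exact: (linearN (lin_r x)). Qed.
Lemma bilBl x y z : u (x - y) z = u x z - u y z.
Proof. by rewrite bilDl bilNl. Qed.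
Lemma bilBr x y z : u x (y - z) = u x y - u x z.
Proof. by rewrite bilDr bilNr. Qed.
Lemma bil_suml n (F : 'I_n -> V) z : u (\sum_i F i) z = \sum_i u (F i) z.
Proof. exact: (linear_sum (lin_l z)). Qed.
Lemma bil_sumr n (F : 'I_n -> V) x : u x (\sum_i F i) = \sum_i u x (F i).
Proof. exact: (linear_sum (lin_r x)). Qed.

Lemma bil_alt : (forall x, u x x = 0) -> forall x y, u x y = - u y x.
Proof.
move=> ualt x y; apply/eqP; rewrite -addr_eq0; apply/eqP.
by have := ualt (x + y); rewrite bilDl !bilDr !ualt addr0 add0r.
Qed.

End Bilinear.

Lemma lie_bilin (K : fieldType) (g : lieAlgType K) : bilin (@lie K g).
Proof. by split=> x; [apply: lie_linearl | apply: lie_linearr]. Qed.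

Section Norm.
Context {R : realType} {V : vectType R} {n : nat} (e : n.-tuple V).
Hypothesis eB : basis_of {:V} e.

(** With the l1 norm, bounds for linear and bilinear maps are sums over the basis
    vectors, and are visibly continuous in the coefficients. *)
Definition l1norm (x : V) : R := \sum_(i < n) `|coord e i x|.

Lemma l1norm_ge0 x : 0 <= l1norm x.
Proof. by apply: sumr_ge0. Qed.

Lemma l1norm_eq0 x : l1norm x = 0 -> x = 0.
Proof.
move=> /eqP; rewrite psumr_eq0 // => /allP x0.
rewrite (coord_basis eB (memvf x)) big1 // => i _.
by have := x0 i (mem_index_enum i); rewrite normr_eq0 => /eqP ->; rewrite scale0r.
Qed.

Lemma l1norm0 : l1norm 0 = 0.
Proof. by rewrite /l1norm big1 // => i _; rewrite linear0 normr0. Qed.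

Lemma l1normD x y : l1norm (x + y) <= l1norm x + l1norm y.
Proof.
by rewrite -big_split; apply: ler_sum => i _; rewrite linearD ler_normD.
Qed.

Lemma l1normN x : l1norm (- x) = l1norm x.
Proof. by apply: eq_bigr => i _; rewrite linearN normrN. Qed.

Lemma l1normZ a x : l1norm (a *: x) = `|a| * l1norm x.
Proof. by rewrite mulr_sumr; apply: eq_bigr => i _; rewrite linearZ normrM. Qed.

Lemma l1norm_sum m (F : 'I_m -> V) : l1norm (\sum_i F i) <= \sum_i l1norm (F i).
Proof.
elim/big_ind2: _ => [|x1 x2 y1 y2 h1 h2|//]; first by rewrite l1norm0.
by apply: le_trans (l1normD _ _) _; apply: lerD.
Qed.

Lemma l1norm_basis (i : 'I_n) : l1norm e`_i = 1.
Proof.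
rewrite /l1norm (bigD1 i) //= coord_free ?(basis_free eB) // eqxx normr1.
rewrite big1 ?addr0 // => j /negPf ji.
by rewrite coord_free ?(basis_free eB) // eq_sym ji normr0.
Qed.

Definition lin_norm (f : 'End(V)) : R := \sum_(i < n) l1norm (f e`_i).

Definition bil_norm (u : V -> V -> V) : R :=
  \sum_(i < n) \sum_(j < n) l1norm (u e`_i e`_j).

Lemma lin_norm_ge0 (f : 'End(V)) : 0 <= lin_norm f.
Proof. by apply: sumr_ge0 => i _; apply: l1norm_ge0. Qed.

Lemma lin_normD (f h : 'End(V)) : lin_norm (f + h)%R <= lin_norm f + lin_norm h.
Proof.
by rewrite -big_split; apply: ler_sum => i _; rewrite add_lfunE l1normD.
Qed.

Lemma lin_normN (f : 'End(V)) : lin_norm (- f)%R = lin_norm f.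
Proof. by apply: eq_bigr => i _; rewrite opp_lfunE l1normN. Qed.

Lemma lin_norm0 : lin_norm 0%R = 0.
Proof. by rewrite /lin_norm big1 // => i _; rewrite zero_lfunE l1norm0. Qed.

Lemma bil_norm_ge0 u : 0 <= bil_norm u.
Proof. by do 2!(apply: sumr_ge0 => ? _); apply: l1norm_ge0. Qed.

Lemma lin_normP (f : 'End(V)) x : l1norm (f x) <= lin_norm f * l1norm x.
Proof.
rewrite {1}(coord_basis eB (memvf x)) linear_sum.
apply: le_trans (l1norm_sum _) _; rewrite mulr_sumr; apply: ler_sum => i _.
rewrite linearZ l1normZ mulrC ler_wpM2r // /lin_norm (bigD1 i) //= lerDl.
by apply: sumr_ge0 => j _; apply: l1norm_ge0.
Qed.

Lemma bil_normP u x y : bilin u ->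
  l1norm (u x y) <= bil_norm u * l1norm x * l1norm y.
Proof.
move=> ub; rewrite {1}(coord_basis eB (memvf x)) (bil_suml ub).
apply: le_trans (l1norm_sum _) _.
rewrite -mulrA (mulrC (l1norm x)) mulrA mulr_sumr; apply: ler_sum => i _.
rewrite (bilZl ub) l1normZ mulrC ler_wpM2r //.
rewrite {1}(coord_basis eB (memvf y)) (bil_sumr ub).
apply: le_trans (l1norm_sum _) _; rewrite mulr_sumr; apply: ler_sum => j _.
rewrite (bilZr ub) l1normZ mulrC ler_wpM2r // /bil_norm.
rewrite (bigD1 i) //= (bigD1 j) //= -addrA lerDl addr_ge0 //.
  by apply: sumr_ge0 => ? _; apply: l1norm_ge0.
by do 2!(apply: sumr_ge0 => ? _); apply: l1norm_ge0.
Qed.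

Lemma lin_norm_le (f : 'End(V)) b : (forall x, l1norm (f x) <= b * l1norm x) ->
  lin_norm f <= n%:R * b.
Proof.
move=> fb; apply: (@le_trans _ _ (\sum_(i < n) b)).
  by apply: ler_sum => i _; rewrite -[b]mulr1 -(l1norm_basis i).
by rewrite sumr_const card_ord mulr_natl.
Qed.

Lemma bil_norm_le u b : (forall x y, l1norm (u x y) <= b * l1norm x * l1norm y) ->
  bil_norm u <= n%:R ^+ 2 * b.
Proof.
move=> ub; apply: (@le_trans _ _ (\sum_(i < n) \sum_(j < n) b)).
  do 2!(apply: ler_sum => ? _).
  by apply: le_trans (ub _ _) _; rewrite !l1norm_basis !mulr1.
by rewrite !sumr_const card_ord -mulrnA expr2 -natrM mulr_natl.
Qed.

Lemma bil_norm_eq0 u : bilin u -> bil_norm u = 0 -> forall x y, u x y = 0.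
Proof.
move=> ub u0 x y; apply: l1norm_eq0; apply/eqP; rewrite eq_le l1norm_ge0 andbT.
by apply: le_trans (bil_normP _ _ ub) _; rewrite u0 !mul0r.
Qed.

End Norm.

(** * Rigidity of semisimple Lie brackets *)

Section Casimir.
Context {R : realType} {g : lieAlgType R} {n : nat} (e : n.-tuple g) (s : 'I_n -> R).
Hypothesis eB : basis_of {:g} e.
Hypothesis ss : forall i, s i * s i = 1.
Hypothesis es : forall i j : 'I_n, killing e`_i e`_j = s i * (i == j)%:R.

Lemma killing_bilin : bilin (fun x y : g => killing x y : R^o).
Proof.
by split=> x a y z; rewrite ?killingDl ?killingDr ?killingZl ?killingZr.
Qed.

Lemma killing_coord (x : g) (i : 'I_n) : killing x e`_i = s i * coord e i x.
Proof.
rewrite {1}(coord_basis eB (memvf x)) (bil_suml killing_bilin) (bigD1 i) //=.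
rewrite killingZl es eqxx mulr1 mulrC big1 ?addr0 // => j /negPf ji.
by rewrite killingZl es ji !mulr0.
Qed.

Lemma coord_killing (x : g) (i : 'I_n) : coord e i x = s i * killing x e`_i.
Proof. by rewrite killing_coord mulrA ss mul1r. Qed.

Lemma killing_expand (x : g) : x = \sum_(i < n) (s i * killing x e`_i) *: e`_i.
Proof.
rewrite {1}(coord_basis eB (memvf x)); apply: eq_bigr => i _.
by rewrite coord_killing.
Qed.

Lemma killing_nondeg (x y : g) : (forall z, killing x z = killing y z) -> x = y.
Proof.
by move=> xy; rewrite (killing_expand x) (killing_expand y); under eq_bigr do rewrite xy.
Qed.

(** As [s m *: e`_m] is the basis dual to [e] for the Killing form, this says
    that the Casimir tensor is invariant; it holds because the matrix of [ad z]
    is skew for that form. *)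
Lemma casimir_invariant (W : lmodType R) (u : g -> g -> W) z : bilin u ->
  \sum_(m < n) s m *: u (lie z e`_m) e`_m =
  - \sum_(m < n) s m *: u e`_m (lie z e`_m).
Proof.
move=> ub; apply/eqP; rewrite -addr_eq0; apply/eqP.
have -> : \sum_(m < n) s m *: u (lie z e`_m) e`_m =
    \sum_(m < n) \sum_(l < n) (s m * s l * killing (lie z e`_m) e`_l) *: u e`_l e`_m.
  apply: eq_bigr => m _; rewrite {1}[lie z _]killing_expand (bil_suml ub) scaler_sumr.
  by apply: eq_bigr => l _; rewrite (bilZl ub) scalerA mulrA.
have -> : \sum_(m < n) s m *: u e`_m (lie z e`_m) =
    \sum_(m < n) \sum_(l < n) (s m * s l * killing (lie z e`_m) e`_l) *: u e`_m e`_l.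
  apply: eq_bigr => m _; rewrite {1}[lie z _]killing_expand (bil_sumr ub) scaler_sumr.
  by apply: eq_bigr => l _; rewrite (bilZr ub) scalerA mulrA.
rewrite [X in _ + X]exchange_big -big_split big1 // => m _ /=.
rewrite -big_split big1 // => l _ /=.
rewrite -scalerDl killing_lie killingC (mulrC (s l)) -mulrDr addNr.
by rewrite mulr0 scale0r.
Qed.

(** Pairing the left-hand side with [y] gives the trace of [ad x \o ad y] in the
    basis [e], so the Casimir element of the Killing form acts as the identity on
    all of [g], simple or not. *)
Lemma casimir_id (x : g) : \sum_(m < n) s m *: lie e`_m (lie e`_m x) = x.
Proof.
apply: killing_nondeg => y; rewrite (bil_suml killing_bilin).
rewrite [RHS]/killing (trace_basis _ eB); apply: eq_bigr => m _.
rewrite killingZl comp_lfunE !adE coord_killing; congr (_ * _).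
rewrite killing_lie (lieC e`_m x) (lieC e`_m y) killingNl killingNr opprK.
by rewrite killing_lie opprK killingC.
Qed.

(** The contraction of a cochain with the Casimir tensor, which lowers degrees
    by one. *)
Definition contract (u : g -> g -> g) (x : g) : g :=
  \sum_(m < n) s m *: lie e`_m (u e`_m x).

Lemma contract_linear u : bilin u -> linear (contract u).
Proof.
move=> ub a x y; rewrite /contract scaler_sumr -big_split; apply: eq_bigr => m _ /=.
by rewrite (bilDr ub) (bilZr ub) linearD linearZ /= scalerDr !scalerA mulrC.
Qed.

(** Up to sign, this is the Chevalley-Eilenberg differential of an alternating
    2-cochain with values in the adjoint representation. *)
Definition cyclic (u : g -> g -> g) (x y z : g) : g :=
  (u (lie x y) z + lie (u x y) z) + (u (lie y z) x + lie (u y z) x)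
  + (u (lie z x) y + lie (u z x) y).

(** Contraction with the Casimir tensor is a homotopy between the action of the
    Casimir element, which is the identity by [casimir_id], and zero: the
    cochain [u] is the differential of [contract u], up to the contraction of its
    own differential. *)
Lemma cochain_homotopy (u : g -> g -> g) x y : bilin u -> (forall x, u x x = 0) ->
  u x y = lie x (contract u y) + lie (contract u x) y - contract u (lie x y)
    - \sum_(m < n) s m *: lie e`_m (cyclic u e`_m x y).
Proof.
move=> ub ualt; have uC := bil_alt ub ualt.
pose S (F : 'I_n -> g) : g := \sum_(m < n) s m *: lie e`_m (F m).
have SD F G : S F + S G = S (fun m => F m + G m).
  by rewrite -big_split; apply: eq_bigr => m _; rewrite lieDr scalerDr.
have SN F : - S F = S (fun m => - F m).
  by rewrite -sumrN; apply: eq_bigr => m _; rewrite lieNr scalerN.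
(* Moving [ad a] across the contraction costs a term in which [a] acts on the
   first argument of [u]. *)
have move_in a b : lie a (contract u b) =
    S (fun m => lie a (u e`_m b) + u (lie e`_m a) b).
  rewrite -SD.
  have -> : S (fun m => u (lie e`_m a) b) =
      \sum_(m < n) s m *: lie (lie a e`_m) (u e`_m b).
    rewrite (@casimir_invariant g (fun p r => lie p (u r b))); last first.
      split=> p k v w; first by rewrite lieDl lieZl.
      by rewrite (bilDl ub) (bilZl ub) lieDr (bilZr (lie_bilin g)).
    rewrite -sumrN; apply: eq_bigr => m _.
    by rewrite (lieC e`_m a) (bilNl ub) lieNr scalerN.
  rewrite (bil_sumr (lie_bilin g)) -big_split; apply: eq_bigr => m _ /=.
  rewrite (bilZr (lie_bilin g)) -scalerDr; congr (_ *: _).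
  by rewrite lie_jacobil addrC subrK.
rewrite (lieC _ y) !move_in -{1}[u x y]casimir_id.
rewrite -[\sum_(m < n) _ *: lie _ (cyclic _ _ _ _)]/(S (fun m => cyclic u e`_m x y)).
rewrite -[contract u _]/(S (fun m => u e`_m (lie x y))).
rewrite !SN !SD; apply: eq_bigr => m _; congr (_ *: lie _ _).
rewrite /cyclic (uC (lie x y)) (lieC y e`_m) (bilNl ub) (uC y).
rewrite (lieC (u x y)) (lieC (u e`_m x)) (lieC (- u _ _)) lieNr.
rewrite !opprD !opprK.
rewrite [RHS](AC ((2*2*1)*((2*2)*2)) (9*(1*11)*(2*6)*(3*7)*(4*10)*(5*8))) /=.
by rewrite !subrr !addNr !addr0.
Qed.

End Casimir.

Definition lie_bracket (K : fieldType) (V : vectType K) (c : V -> V -> V) : Prop :=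
  [/\ bilin c, forall x, c x x = 0 &
      forall x y z, c x (c y z) + c y (c z x) + c z (c x y) = 0].

Section Newton.
Context {R : realType} {g : lieAlgType R} {n : nat} (e : n.-tuple g) (s : 'I_n -> R).
Hypothesis eB : basis_of {:g} e.
Hypothesis ss : forall i, s i * s i = 1.
Hypothesis es : forall i j : 'I_n, killing e`_i e`_j = s i * (i == j)%:R.

Notation nrm := (l1norm e).
Notation lnrm := (lin_norm e).
Notation bnrm := (bil_norm e).

(** The error of [h] as a homomorphism from [c] to the bracket of [g]. *)
Definition defect (c : g -> g -> g) (h : 'End(g)) (x y : g) : g :=
  h (c x y) - lie (h x) (h y).

Section Cochain.
Variables (c : g -> g -> g) (h : 'End(g)).
Hypothesis cP : lie_bracket c.

Lemma defect_bilin : bilin (defect c h).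
Proof.
have hP b v w : h (b *: v + w) = b *: h v + h w by apply: linearP.
have [cb _ _] := cP; split=> z a x y; rewrite /defect.
  rewrite (bilDl cb) (bilZl cb) !hP lieDl lieZl.
  by rewrite scalerBr opprD addrACA.
rewrite (bilDr cb) (bilZr cb) !hP lieDr (bilZr (lie_bilin g)).
by rewrite scalerBr opprD addrACA.
Qed.

Lemma defect_alt x : defect c h x x = 0.
Proof. by have [_ c0 _] := cP; rewrite /defect c0 linear0 liexx subr0. Qed.

(** The Jacobi identities of both brackets give an exact cocycle identity.  If
    [c] is close to the bracket of [g] and [h] to the identity, the defect is
    therefore almost a cocycle in the sense of [cyclic]. *)
Lemma defect_cyclic x y z :
  let u := defect c h in
  (u (c x y) z + lie (u x y) (h z)) + (u (c y z) x + lie (u y z) (h x))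
  + (u (c z x) y + lie (u z x) (h y)) = 0.
Proof.
have [cb c0 cJ] := cP; have cC := bil_alt cb c0.
have E p q r : defect c h (c p q) r + lie (defect c h p q) (h r) =
    - h (c r (c p q)) + lie (h r) (lie (h p) (h q)).
  rewrite /defect lieDl lieNl (cC _ r) linearN /= (lieC (lie _ _) (h r)) opprK.
  by rewrite addrA subrK.
rewrite /= !E [LHS](AC ((2*2)*2) ((1*3*5)*(2*4*6))) /=.
have hD v w : h v + h w = h (v + w) by rewrite linearD.
rewrite -!opprD !hD [X in h X](AC (2*1) ((2*3)*1)) /= cJ linear0 oppr0 add0r.
by rewrite [LHS](AC (2*1) ((2*3)*1)) /= lie_jacobi.
Qed.


End Cochain.
Lemma bracket_sub_bilin (c : g -> g -> g) : lie_bracket c ->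
  bilin (fun x y => c x y - lie x y).
Proof.
case=> cb _ _; split=> z a x y.
  by rewrite (bilDl cb) (bilZl cb) lieDl lieZl scalerBr opprD addrACA.
rewrite (bilDr cb) (bilZr cb) lieDr (bilZr (lie_bilin g)).
by rewrite scalerBr opprD addrACA.
Qed.

(** The correction is [A = contract u], where [u] is the defect of [h].  By
    [cochain_homotopy] the differential of [A] cancels [u] up to the contraction
    of [cyclic u], which is small by [defect_cyclic].  Each term of the new
    defect thus contains [u] and a second small factor: the distance from [c] to
    the bracket of [g], the distance from [h] to the identity, or [u] itself. *)
Lemma newton_step : exists2 K : R, 0 <= K & forall c h, lie_bracket c ->
  exists2 A : 'End(g), lnrm A <= K * bnrm (defect c h) &
    bnrm (defect c (h + A)%R) <= K * bnrm (defect c h) *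
      (bnrm (fun x y => c x y - lie x y) + lnrm (\1%VF - h)%R + bnrm (defect c h)).
Proof.
pose L := bnrm (@lie _ g); pose nn : R := n%:R.
have L0 : 0 <= L by apply: bil_norm_ge0.
have nn0 : 0 <= nn by apply: ler0n.
have LP x y : nrm (lie x y) <= L * nrm x * nrm y := bil_normP eB x y (lie_bilin g).
(* The coefficients collect the bounds [t1] to [t5] below. *)
pose K1 := 4 * nn * L + 5 * nn * L ^+ 2 + nn ^+ 2 * L ^+ 3.
have K10 : 0 <= K1 by rewrite /K1 !addr_ge0 ?mulr_ge0 ?exprn_ge0.
exists (nn ^+ 2 * K1 + nn * (nn * L)).
  by rewrite addr_ge0 ?mulr_ge0 ?exprn_ge0.
move=> c h cP; set u := defect c h; set U := bnrm u.
have ub : bilin u := defect_bilin h cP; have ualt : forall x, u x x = 0 := defect_alt h cP.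
have U0 : 0 <= U by apply: bil_norm_ge0.
have uP x y : nrm (u x y) <= U * nrm x * nrm y := bil_normP eB x y ub.
set al := bnrm _; have al0 : 0 <= al by apply: bil_norm_ge0.
have alP x y : nrm (c x y - lie x y) <= al * nrm x * nrm y.
  exact: (bil_normP eB x y (bracket_sub_bilin cP)).
set ka := lnrm _; have ka0 : 0 <= ka by apply: lin_norm_ge0.
have kaP x : nrm (x - h x) <= ka * nrm x.
  by have := lin_normP eB (\1%VF - h)%R x; rewrite add_lfunE opp_lfunE id_lfunE.
have nrm0 x : 0 <= nrm x := l1norm_ge0 e x.
have sn m (x : g) : nrm (s m *: x) = nrm x.
  have sm : `|s m| = 1.
    by apply/eqP; rewrite -(@eqrXn2 _ 2) // -normrX expr2 ss expr1n normr1.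
  by rewrite l1normZ sm mul1r.
pose A := lin_hom (contract_linear e s ub).
have AE x : A x = contract e s u x by rewrite lin_homE.
have AP x : nrm (A x) <= nn * L * U * nrm x.
  rewrite AE; apply: le_trans (l1norm_sum _ _) _.
  apply: (@le_trans _ _ (\sum_(m < n) L * U * nrm x)).
    apply: ler_sum => m _; rewrite sn; apply: le_trans (LP _ _) _.
    rewrite (l1norm_basis eB) mulr1 -mulrA ler_wpM2l //.
    by apply: le_trans (uP _ _) _; rewrite (l1norm_basis eB) mulr1.
  by rewrite sumr_const card_ord -mulr_natl /nn !mulrA.
exists A.
  apply: le_trans (lin_norm_le eB AP) _; rewrite -/nn !mulrA ler_wpM2r //.
  by rewrite lerDr mulr_ge0 ?exprn_ge0.
have cyc_le x y z : nrm (cyclic u x y z) <=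
    3 * (U * (al + L * ka)) * nrm x * nrm y * nrm z.
  have -> : cyclic u x y z =
    - ((u (c x y - lie x y) z - lie (u x y) (z - h z))
     + (u (c y z - lie y z) x - lie (u y z) (x - h x))
     + (u (c z x - lie z x) y - lie (u z x) (y - h y))).
    have FE p q r : u (lie p q) r + lie (u p q) r =
        u (c p q) r + lie (u p q) (h r)
        - (u (c p q - lie p q) r - lie (u p q) (r - h r)).
      rewrite (bilBl ub) (bilBr (lie_bilin g)) opprB opprB.
      by rewrite [RHS](AC (2*(2*2)) ((5*3)*(1*6)*(2*4))) /= !subrr !addr0.
    rewrite /cyclic !FE [X in X + _]addrACA -opprD addrACA -opprD.
    by have /= -> := defect_cyclic h cP x y z; rewrite add0r.
  have one p q r : nrm (u (c p q - lie p q) r - lie (u p q) (r - h r)) <=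
      U * (al + L * ka) * nrm p * nrm q * nrm r.
    apply: le_trans (l1normD _ _ _) _; rewrite l1normN.
    have -> : U * (al + L * ka) * nrm p * nrm q * nrm r =
      U * (al * nrm p * nrm q) * nrm r + L * (U * nrm p * nrm q) * (ka * nrm r).
      by ring.
    apply: lerD; first apply: le_trans (uP _ _) _.
      by rewrite ler_wpM2r // ler_wpM2l.
    apply: le_trans (LP _ _) _.
    by rewrite ler_pM // ?ler_wpM2l // mulr_ge0.
  rewrite l1normN; apply: le_trans (l1normD _ _ _) _.
  have -> : 3 * (U * (al + L * ka)) * nrm x * nrm y * nrm z =
     (U * (al + L * ka) * nrm x * nrm y * nrm z
     + U * (al + L * ka) * nrm y * nrm z * nrm x)
     + U * (al + L * ka) * nrm z * nrm x * nrm y by ring.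
  apply: lerD => //; apply: le_trans (l1normD _ _ _) _; exact: lerD.
have newE x y : defect c (h + A)%R x y =
    (A (c x y - lie x y) - \sum_(m < n) s m *: lie e`_m (cyclic u e`_m x y))
    + (lie (A x) (y - h y) + lie (x - h x) (A y) - lie (A x) (A y)).
  rewrite /defect !add_lfunE lieDl !lieDr.
  have := cochain_homotopy eB ss es x y ub ualt.
  rewrite -!AE {1}/u /defect !(lieDl, lieDr, lieNl, lieNr) linearB /= => H.
  rewrite !opprD [LHS](AC (2*(2*2)) ((1*3)*(2*4*5*6))) /= H.
  by rewrite [RHS](AC ((2*1)*((2*2)*1)) ((6*4*2*3)*(1*5*7*8))).
have aU0 : 0 <= nn * L * U by rewrite !mulr_ge0.
have defect_le x y : nrm (defect c (h + A)%R x y) <=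
    K1 * (U * (al + ka + U)) * nrm x * nrm y.
  rewrite newE; set X := nrm x; set Y := nrm y.
  have X0 : 0 <= X := nrm0 x; have Y0 : 0 <= Y := nrm0 y.
  have t1 : nrm (A (c x y - lie x y)) <= nn * L * U * (al * X * Y).
    by apply: le_trans (AP _) _; rewrite ler_wpM2l.
  have t2 : nrm (\sum_(m < n) s m *: lie e`_m (cyclic u e`_m x y)) <=
      nn * (L * (3 * (U * (al + L * ka)) * X * Y)).
    apply: le_trans (l1norm_sum _ _) _.
    apply: (@le_trans _ _ (\sum_(m < n) L * (3 * (U * (al + L * ka)) * X * Y)));
      last by rewrite sumr_const card_ord /nn [leRHS]mulr_natl.
    apply: ler_sum => m _; rewrite sn; apply: le_trans (LP _ _) _.
    rewrite (l1norm_basis eB) mulr1 ler_wpM2l //.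
    by apply: le_trans (cyc_le _ _ _) _; rewrite (l1norm_basis eB) mulr1.
  have lie_le v w a b : nrm v <= a -> nrm w <= b -> nrm (lie v w) <= L * a * b.
    move=> va wb; apply: le_trans (LP _ _) _.
    by apply: ler_pM => //; [rewrite mulr_ge0|rewrite ler_wpM2l].
  have t3 : nrm (lie (A x) (y - h y)) <= L * (nn * L * U * X) * (ka * Y).
    exact: lie_le.
  have t4 : nrm (lie (x - h x) (A y)) <= L * (ka * X) * (nn * L * U * Y).
    exact: lie_le.
  have t5 : nrm (lie (A x) (A y)) <= L * (nn * L * U * X) * (nn * L * U * Y).
    exact: lie_le.
  apply: (@le_trans _ _ (U * ((4 * nn * L) * al + (5 * nn * L ^+ 2) * ka
                          + nn ^+ 2 * L ^+ 3 * U) * X * Y)).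
    have -> : U * ((4 * nn * L) * al + (5 * nn * L ^+ 2) * ka
                          + nn ^+ 2 * L ^+ 3 * U) * X * Y =
      (nn * L * U * (al * X * Y) + nn * (L * (3 * (U * (al + L * ka)) * X * Y)))
      + (L * (nn * L * U * X) * (ka * Y) + L * (ka * X) * (nn * L * U * Y)
         + L * (nn * L * U * X) * (nn * L * U * Y)) by ring.
    apply: le_trans (l1normD _ _ _) _; apply: lerD.
      by apply: le_trans (l1normD _ _ _) _; rewrite l1normN; apply: lerD.
    apply: le_trans (l1normD _ _ _) _; rewrite l1normN; apply: lerD => //.
    by apply: le_trans (l1normD _ _ _) _; apply: lerD.
  do 2!(apply: ler_wpM2r => //); rewrite [leRHS]mulrCA ler_wpM2l // /K1.
  have [p0 r0 w0] : [/\ 0 <= 4 * nn * L, 0 <= 5 * nn * L ^+ 2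
                      & 0 <= nn ^+ 2 * L ^+ 3].
    by rewrite !mulr_ge0 ?exprn_ge0.
  move: (4 * nn * L) (5 * nn * L ^+ 2) (nn ^+ 2 * L ^+ 3) p0 r0 w0 => p r w p0 r0 w0.
  have nneg := (mulr_ge0 p0 ka0, mulr_ge0 p0 U0, mulr_ge0 r0 al0, mulr_ge0 r0 U0,
    mulr_ge0 w0 al0, mulr_ge0 w0 ka0).
  by case: nneg => -[[[[? ?] ?] ?] ?] ?; lra.
apply: le_trans (bil_norm_le eB defect_le) _.
rewrite -/nn mulrA -[leRHS]mulrA; apply: ler_wpM2r.
  by rewrite mulr_ge0 ?addr_ge0.
by rewrite lerDl !mulr_ge0.
Qed.

End Newton.

Section VectorContinuity.
Local Open Scope classical_set_scope.
Context {R : realType} {T : topologicalType} {V : vectType R} {n : nat}.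
Variable e : n.-tuple V.
Hypothesis eB : basis_of {:V} e.

Definition vcont (F : T -> V) : Prop :=
  forall k : 'I_n, continuous (fun t => coord e k (F t)).

Lemma vcont_cst (v : V) : vcont (fun=> v).
Proof. by move=> k; apply: cont_cst. Qed.

Lemma vcont_add F G : vcont F -> vcont G -> vcont (fun t => F t + G t).
Proof.
by move=> Fc Gc k; under eq_fun do rewrite linearD; apply: cont_add; [apply: Fc|apply: Gc].
Qed.

Lemma vcont_sub F G : vcont F -> vcont G -> vcont (fun t => F t - G t).
Proof.
by move=> Fc Gc k; under eq_fun do rewrite linearB; apply: cont_sub; [apply: Fc|apply: Gc].
Qed.

Lemma vcont_scale (f : T -> R) F : continuous f -> vcont F ->
  vcont (fun t => f t *: F t).
Proof.
by move=> fc Fc k; under eq_fun do rewrite linearZ; apply: cont_mul; [apply: fc|apply: Fc].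
Qed.

Lemma vcont_sum m (F : 'I_m -> T -> V) :
  (forall i, vcont (F i)) -> vcont (fun t => \sum_i F i t).
Proof.
by move=> Fc k; under eq_fun do rewrite linear_sum; apply: cont_sum => i; apply: Fc.
Qed.

Lemma vcont_bil (u : V -> V -> V) F G : bilin u -> vcont F -> vcont G ->
  vcont (fun t => u (F t) (G t)).
Proof.
move=> ub Fc Gc; have -> : (fun t => u (F t) (G t)) = fun t =>
    \sum_i coord e i (F t) *: \sum_j coord e j (G t) *: u e`_i e`_j.
  apply: funext => t; rewrite {1}(coord_basis eB (memvf (F t))) (bil_suml ub).
  apply: eq_bigr => i _; rewrite (bilZl ub) {1}(coord_basis eB (memvf (G t))).
  by rewrite (bil_sumr ub); congr (_ *: _); apply: eq_bigr => j _; rewrite (bilZr ub).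
apply: vcont_sum => i; apply: vcont_scale => //; apply: vcont_sum => j.
by apply: vcont_scale => //; apply: vcont_cst.
Qed.

Lemma cont_l1norm F : vcont F -> continuous (fun t => l1norm e (F t)).
Proof. by move=> Fc; apply: cont_sum => i; apply: cont_norm. Qed.

Lemma cont_lin_norm (f : T -> 'End(V)) :
  (forall i : 'I_n, vcont (fun t => f t e`_i)) ->
  continuous (fun t => lin_norm e (f t)).
Proof. by move=> fc; apply: cont_sum => i; apply: cont_l1norm. Qed.

Lemma cont_bil_norm (u : T -> V -> V -> V) :
  (forall i j : 'I_n, vcont (fun t => u t e`_i e`_j)) ->
  continuous (fun t => bil_norm e (u t)).
Proof. by move=> uc; do 2!(apply: cont_sum => ?); apply: cont_l1norm. Qed.

End VectorContinuity.

Section Rigidity.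
Local Open Scope classical_set_scope.
Context {R : realType} {g : lieAlgType R} {n : nat} (e : n.-tuple g) (s : 'I_n -> R).
Hypothesis eB : basis_of {:g} e.
Hypothesis ss : forall i, s i * s i = 1.
Hypothesis es : forall i j : 'I_n, killing e`_i e`_j = s i * (i == j)%:R.

Notation nrm := (l1norm e).
Notation lnrm := (lin_norm e).
Notation bnrm := (bil_norm e).
Notation M := {ptws 'I_n * 'I_n -> R}.

Fact end_of_subproof (m : M) :
  linear (fun x : g => \sum_(i < n) coord e i x *: \sum_(k < n) m (i, k) *: e`_k).
Proof.
move=> a x y; rewrite scaler_sumr -big_split; apply: eq_bigr => i _ /=.
by rewrite linearP scalerDl scalerA.
Qed.

Definition end_of (m : M) : 'End(g) := lin_hom (end_of_subproof m).

Lemma end_of_basis m (i : 'I_n) : end_of m e`_i = \sum_(k < n) m (i, k) *: e`_k.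
Proof.
rewrite lin_homE (bigD1 i) //= coord_free ?(basis_free eB) // eqxx scale1r.
rewrite [X in _ + X]big1 ?addr0 // => j /negPf ji.
by rewrite coord_free ?(basis_free eB) // eq_sym ji scale0r.
Qed.

Lemma end_ofK (h : 'End(g)) : end_of (fun ik => coord e ik.2 (h e`_ik.1)) = h.
Proof.
apply: (basis_ext eB) => i; rewrite end_of_basis.
by rewrite {2}(coord_basis eB (memvf (h _))).
Qed.

Lemma vcont_end_of x : vcont e (fun m : M => end_of m x).
Proof.
have -> : (fun m : M => end_of m x) = fun m : M =>
    \sum_(i < n) coord e i x *: \sum_(k < n) m (i, k) *: e`_k.
  by apply: funext => m; rewrite lin_homE.
apply: vcont_sum => i; apply: vcont_scale; first exact: cont_cst.
apply: vcont_sum => k; apply: vcont_scale; last exact: vcont_cst.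
exact: (@cont_coord R _ (i, k)).
Qed.

Lemma near1_bijective (h : 'End(g)) : lnrm (\1%VF - h)%R <= 2^-1 ->
  exists hi : 'End(g), cancel h hi /\ cancel hi h.
Proof.
move=> h1; exists (h^-1)%VF.
suff k0 : lker h == 0%VS.
  by split; [apply: lker0_lfunK | apply: lker0_lfunVK].
rewrite -subv0; apply/subvP => x; rewrite memv_ker memv0 => /eqP hx.
apply/eqP/(l1norm_eq0 eB)/eqP.
have := lin_normP eB (\1%VF - h)%R x.
rewrite add_lfunE opp_lfunE id_lfunE hx subr0 => le.
have := l1norm_ge0 e x; have := le_trans le (ler_wpM2r (l1norm_ge0 e x) h1).
by move=> ? ?; apply/eqP; lra.
Qed.

(** The functional [G h], the norm of the defect plus [dl] times the distance to
    the identity, has a minimum [h] on a ball around the identity.  The second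
    term keeps [h], and the result of a step of Newton's method from [h], inside
    that ball, since [G \1] is small.  Such a step at least halves the defect and
    moves [h] by at most [K] times the defect, so it would decrease [G] strictly
    if the defect were not zero. *)
Theorem rigidity : exists2 a0 : R, 0 < a0 & forall c : g -> g -> g,
  lie_bracket c -> bnrm (fun x y => c x y - lie x y) < a0 ->
  exists h hi : 'End(g), [/\ cancel h hi, cancel hi h &
    forall x y, h (c x y) = lie (h x) (h y)].
Proof.
have [K K0 newton] := newton_step eB ss es.
(* Small enough for [dl * K <= 1 / 4], so that a step costs less in the second
   term of [G] than it gains in the first. *)
pose dl : R := (4 * (K + 1))^-1.
have K1 : 0 < K + 1 by rewrite ltr_wpDl.
have dl0 : 0 < dl by rewrite invr_gt0 mulr_gt0.
have dlK : 4 * dl * (K + 1) = 1 by rewrite /dl; field; rewrite gt_eqF.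
(* If [G \1 < dl ^+ 2] then [G h < dl ^+ 2], so [h] is at distance at most [dl]
   from the identity. *)
exists (dl ^+ 2); first by rewrite exprn_gt0.
move=> c cP; set al := bnrm _ => al_lt.
have [cb _ _] := cP.
pose G (h : 'End(g)) : R := bnrm (defect c h) + dl * lnrm (\1%VF - h)%R.
pose f (m : M) := G (end_of m).
have lin_cont : continuous (fun m => lnrm (\1%VF - end_of m)%R).
  apply: cont_lin_norm => i.
  have -> : (fun m => (\1%VF - end_of m)%R e`_i) = fun m => e`_i - end_of m e`_i.
    by apply: funext => m; rewrite add_lfunE opp_lfunE id_lfunE.
  by apply: vcont_sub; [apply: vcont_cst | apply: vcont_end_of].
have fc : continuous f.
  apply: cont_add; last by apply: cont_mul => //; apply: cont_cst.
  apply: cont_bil_norm => i j; apply: vcont_sub; first exact: vcont_end_of.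
  by apply: (vcont_bil eB (lie_bilin g)); apply: vcont_end_of.
pose box : set M := [set m | lnrm (\1%VF - end_of m)%R <= 2^-1].
have boxc : closed box by apply: closed_le_cst.
have box_bound (m : M) ik : box m -> `|m ik| <= 2.
  case: ik => i k; rewrite /box /= => mbox.
  have -> : m (i, k) = coord e k (end_of m e`_i).
    rewrite end_of_basis linear_sum (bigD1 k) //= linearZ /=.
    rewrite coord_free ?(basis_free eB) // eqxx mulr1 big1 ?addr0 // => j /negPf jk.
    by rewrite linearZ /= coord_free ?(basis_free eB) // jk mulr0.
  have -> : end_of m e`_i = e`_i - (\1%VF - end_of m)%R e`_i.
    by rewrite add_lfunE opp_lfunE id_lfunE opprB addrC subrK.
  apply: (@le_trans _ _ (nrm (e`_i - (\1%VF - end_of m)%R e`_i))).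
    by rewrite [leRHS](bigD1 k) //= lerDl sumr_ge0.
  apply: le_trans (l1normD _ _ _) _; rewrite l1normN (l1norm_basis eB).
  have := lin_normP eB (\1%VF - end_of m)%R e`_i.
  by rewrite (l1norm_basis eB) mulr1 => ?; lra.
pose mat h : M := fun ik => coord e ik.2 (h e`_ik.1).
have box1 : box (mat \1%VF).
  by rewrite /box /= end_ofK subrr lin_norm0 invr_ge0.
have [m mbox mmin] := bounded_closed_min fc boxc box_bound box1.
pose h := end_of m.
have G1 : G \1%VF = al.
  rewrite /G subrr lin_norm0 mulr0 addr0; congr (bil_norm e _).
  by apply: funext => x; apply: funext => y; rewrite /defect !id_lfunE.
have Gh_le : G h <= al by rewrite -G1; have := mmin _ box1; rewrite /f end_ofK.
have U0 : 0 <= bnrm (defect c h) by apply: bil_norm_ge0.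
have ka0 : 0 <= lnrm (\1%VF - h)%R by apply: lin_norm_ge0.
have [hi [hK hiK]] := near1_bijective mbox.
exists h, hi; split=> // x y; apply/eqP; rewrite -subr_eq0; apply/eqP.
apply: (bil_norm_eq0 eB (defect_bilin h cP)).
have [A Ale dle] := newton c h cP.
set U := bnrm _ in U0 Ale dle *; set ka := lnrm _ in ka0 dle.
apply/eqP; apply: contraT => Un0; have Ugt : 0 < U by rewrite lt0r Un0.
have Gh : G h = U + dl * ka by [].
rewrite Gh in Gh_le.
have ka' : lnrm (\1%VF - (h + A))%R <= ka + lnrm A.
  rewrite opprD addrA; apply: le_trans (lin_normD _ _ _) _.
  by rewrite lin_normN.
have dlK' : dl * K <= 4^-1 by lra.
have dl4 : dl <= 4^-1 by have := mulr_ge0 (ltW dl0) K0; lra.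
have al_dl : dl ^+ 2 <= dl * 4^-1 by rewrite expr2 ler_wpM2l // ltW.
have ka_dl : ka <= dl.
  rewrite -(ler_pM2l dl0) -expr2; lra.
have small : K * (al + ka + U) <= 2^-1.
  apply: (@le_trans _ _ (K * (dl * 2^-1 * 3))); last by lra.
  apply: ler_wpM2l => //; have := mulr_ge0 (ltW dl0) ka0; lra.
have dle2 : bnrm (defect c (h + A)%R) <= U * 2^-1.
  apply: le_trans dle _; rewrite [K * U]mulrC -mulrA; exact: ler_wpM2l.
have Glt : G (h + A)%R < U + dl * ka.
  apply: (@le_lt_trans _ _ (U * 2^-1 + dl * (ka + K * U))).
    by apply: lerD => //; apply: ler_wpM2l; [apply: ltW | lra].
  have := ler_wpM2r U0 dlK'; lra.
have mem : box (mat (h + A)%R).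
  rewrite /box /= end_ofK; apply: (@le_trans _ _ dl); last by lra.
  rewrite -(ler_pM2l dl0) -expr2.
  have := bil_norm_ge0 e (defect c (h + A)%R); move: Glt; rewrite /G; lra.
by have := mmin _ mem; rewrite /f end_ofK -/h Gh leNgt Glt.
Qed.

End Rigidity.

(** * A bracket of minimal norm *)

Section Twist.
Context {K : fieldType} {V : vectType K} {c : V -> V -> V}.

(** A copy of [V] that carries the bracket [c] as its Lie algebra structure. *)
Definition twist (cP : lie_bracket c) : Type := V.

Variable cP : lie_bracket c.

HB.instance Definition _ := Vector.copy (twist cP) V.
HB.instance Definition _ := Vector_isLieAlgebra.Build K (twist cP)
  (let: And3 cb _ _ := cP in cb.1) (let: And3 cb _ _ := cP in cb.2)
  (let: And3 _ c0 _ := cP in c0) (let: And3 _ _ cJ := cP in cJ).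

Lemma twist_lie (x y : twist cP) : lie x y = c x y.
Proof. by []. Qed.

End Twist.

Section Orbit.
Local Open Scope classical_set_scope.
Context {R : realType} {g : lieAlgType R} {n : nat} (e : n.-tuple g) (s : 'I_n -> R).
Hypothesis eB : basis_of {:g} e.
Hypothesis ss : forall i, s i * s i = 1.
Hypothesis es : forall i j : 'I_n, killing e`_i e`_j = s i * (i == j)%:R.

Notation T := {ptws 'I_n * 'I_n * 'I_n -> R}.

Definition bracket_of (t : T) (x y : g) : g :=
  \sum_(i < n) coord e i x *: \sum_(j < n) coord e j y *:
    \sum_(k < n) t (i, j, k) *: e`_k.

Definition constants_of (c : g -> g -> g) : T :=
  fun ijk => coord e ijk.2 (c e`_ijk.1.1 e`_ijk.1.2).

Lemma bracket_of_bilin t : bilin (bracket_of t).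
Proof.
split=> z a x y; rewrite /bracket_of scaler_sumr -big_split; apply: eq_bigr => i _ /=.
  by rewrite linearP scalerDl scalerA.
rewrite scalerA mulrC -scalerA -scalerDr; congr (_ *: _).
rewrite scaler_sumr -big_split; apply: eq_bigr => j _ /=.
by rewrite linearP scalerDl scalerA.
Qed.

Lemma bracket_ofK c : bilin c -> bracket_of (constants_of c) = c.
Proof.
move=> cb; apply: funext => x; apply: funext => y.
rewrite [in RHS](coord_basis eB (memvf x)) (bil_suml cb); apply: eq_bigr => i _.
rewrite (bilZl cb) [in RHS](coord_basis eB (memvf y)) (bil_sumr cb); congr (_ *: _).
apply: eq_bigr => j _; rewrite (bilZr cb); congr (_ *: _).
by rewrite [in RHS](coord_basis eB (memvf (c _ _))).
Qed.

Lemma coord_bracket_of t (i j k : 'I_n) :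
  coord e k (bracket_of t e`_i e`_j) = t (i, j, k).
Proof.
have delta (l m : 'I_n) : coord e l e`_m = (m == l)%:R by rewrite coord_free ?(basis_free eB).
rewrite /bracket_of (bigD1 i) //= delta eqxx scale1r [X in _ + X]big1 => [|l]; last first.
  by rewrite eq_sym => /negPf li; rewrite delta li scale0r.
rewrite addr0 (bigD1 j) //= delta eqxx scale1r [X in _ + X]big1 => [|l]; last first.
  by rewrite eq_sym => /negPf lj; rewrite delta lj scale0r.
rewrite addr0 linear_sum (bigD1 k) //= linearZ /= delta eqxx mulr1 big1 ?addr0 //.
by move=> l /negPf lk; rewrite linearZ /= delta lk mulr0.
Qed.

Lemma vcont_bracket F G : vcont e F -> vcont e G ->
  vcont e (fun t : T => bracket_of t (F t) (G t)).
Proof.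
move=> Fc Gc; apply: vcont_sum => i; apply: vcont_scale => //.
apply: vcont_sum => j; apply: vcont_scale => //.
apply: vcont_sum => k; apply: vcont_scale; last exact: vcont_cst.
exact: (@cont_coord R _ (i, j, k)).
Qed.

(** The Killing form of the bracket [c], written in the basis [e] so that it
    makes sense, and is continuous, for arbitrary [c]. *)
Definition trace_form (c : g -> g -> g) (x y : g) : R :=
  \sum_(i < n) coord e i (c x (c y e`_i)).

Lemma killing_twist c (cP : lie_bracket c) (x y : twist cP) :
  killing x y = trace_form c x y.
Proof.
rewrite /killing (@trace_basis _ (twist cP) _ _ _ eB).
by apply: eq_bigr => i _; rewrite comp_lfunE !adE.
Qed.

Definition sq_norm (c : g -> g -> g) : R :=
  \sum_(i < n) \sum_(j < n) \sum_(k < n) coord e k (c e`_i e`_j) ^+ 2.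

Definition in_orbit (c : g -> g -> g) : Prop :=
  [/\ lie_bracket c, forall x y, trace_form c x y = killing x y &
      exists h hi : 'End(g), [/\ cancel h hi, cancel hi h &
        forall x y, h (lie x y) = c (h x) (h y)]].

Lemma vcont_eq0 (A : set T) (F : T -> g) t : vcont e F ->
  closure A t -> (forall t', A t' -> F t' = 0) -> F t = 0.
Proof.
move=> Fc At A0; rewrite (coord_basis eB (memvf (F t))) big1 // => k _.
suff -> : coord e k (F t) = 0 by rewrite scale0r.
have cl := closed_eq_cst (a := 0) (Fc k).
have sub : A `<=` [set t | coord e k (F t) = 0] by move=> t' /A0 /= ->; rewrite linear0.
by have := closure_subset sub At; rewrite -(closure_id _).1.
Qed.

Lemma cont_eq (A : set T) (f : T -> R) a t : continuous f ->
  closure A t -> (forall t', A t' -> f t' = a) -> f t = a.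
Proof.
move=> fc At Aa; have cl := closed_eq_cst (a := a) fc.
have sub : A `<=` [set t | f t = a] by move=> t' /Aa.
by have := closure_subset sub At; rewrite -(closure_id _).1.
Qed.

(** The Jacobi identity and the value of the Killing form pass to a limit [t].
    The limit is then rigid, and brackets of the orbit that are close to it are
    isomorphic to it. *)
Lemma orbit_closed : closed [set t | in_orbit (bracket_of t)].
Proof.
set A := [set t | _] => t At.
have id_c (x : g) : vcont e (fun _ : T => x) by apply: vcont_cst.
have cP : lie_bracket (bracket_of t).
  split; first exact: bracket_of_bilin.
    move=> x; apply: (vcont_eq0 (F := fun t => bracket_of t x x) _ At).
      exact: vcont_bracket.
    by move=> t' [[_ c0 _] _ _]; apply: c0.
  move=> x y z; pose F t := bracket_of t x (bracket_of t y z) +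
    bracket_of t y (bracket_of t z x) + bracket_of t z (bracket_of t x y).
  apply: (vcont_eq0 (F := F) _ At).
    do 2?apply: vcont_add; do 2!apply: vcont_bracket => //.
  by move=> t' [[_ _ cJ] _ _]; apply: cJ.
have form x y : trace_form (bracket_of t) x y = killing x y.
  apply: (cont_eq (f := fun t => trace_form (bracket_of t) x y) _ At).
    apply: cont_sum => i.
    have bb : vcont e (fun t : T => bracket_of t x (bracket_of t y e`_i)).
      by do 2!apply: vcont_bracket => //.
    exact: bb.
  by move=> t' [].
have es' (i j : 'I_n) : killing (e`_i : twist cP) e`_j = s i * (i == j)%:R.
  by rewrite killing_twist form es.
have [a0 a0_gt rig] := @rigidity R (twist cP) n e s eB ss es'.
pose d t' := bil_norm e (fun x y => bracket_of t' x y - bracket_of t x y).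
have dc : continuous d.
  apply: cont_bil_norm => i j; apply: vcont_sub; last exact: vcont_cst.
  exact: vcont_bracket.
have [t' [[cP' _ [h [hi [hK hiK hh]]]] near']] : A `&` [set t' | d t' < a0] !=set0.
  apply: (At [set t' | d t' < a0]); apply: (dc t [set r | r < a0]).
  apply: lt_nbhsl.
  rewrite /d /bil_norm big1 // => i _; rewrite big1 // => j _.
  by rewrite subrr l1norm0.
have [k [ki [kK kiK kh]]] := rig _ cP' near'.
split=> //; exists (k \o h)%VF, (hi \o ki)%VF.
split=> [x|x|x y]; rewrite !comp_lfunE ?kK ?hiK //.
by rewrite hh kh.
Qed.

Theorem minimal_bracket : exists2 c, in_orbit c &
  forall c', in_orbit c' -> sq_norm c <= sq_norm c'.
Proof.
pose A := [set t : T | in_orbit (bracket_of t) /\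
                       sq_norm (bracket_of t) <= sq_norm (@lie _ g)].
pose f (t : T) := sq_norm (bracket_of t).
have fc : continuous f.
  apply: cont_sum => i; apply: cont_sum => j; apply: cont_sum => k.
  have bb : vcont e (fun t : T => bracket_of t e`_i e`_j).
    by apply: vcont_bracket; apply: vcont_cst.
  by apply: cont_sqr; apply: bb.
have Acl : closed A.
  by apply: closedI; [apply: orbit_closed | apply: closed_le_cst].
have lieA : A (constants_of (@lie _ g)).
  rewrite /A /= bracket_ofK; last exact: lie_bilin.
  split=> //; split.
  - split; [exact: lie_bilin | exact: liexx | exact: lie_jacobi].
  - move=> x y; rewrite /killing (trace_basis _ eB).
    by apply: eq_bigr => i _; rewrite comp_lfunE !adE.
  - by exists \1%VF, \1%VF; split=> [x|x|x y]; rewrite !id_lfunE.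
have [t [[i j] k] [_ tle]|t [tO _] tmin] :=
    bounded_closed_min (M := sq_norm (@lie _ g) + 1) fc Acl _ lieA.
  rewrite -coord_bracket_of; set x := coord _ _ _.
  have x2 : x ^+ 2 <= sq_norm (@lie _ g).
    apply: le_trans tle; rewrite /sq_norm (bigD1 i) //= (bigD1 j) //= (bigD1 k) //=.
    rewrite -!addrA lerDl !addr_ge0 //; first by apply: sumr_ge0 => l _; apply: sqr_ge0.
      by do 2!(apply: sumr_ge0 => ? _); apply: sqr_ge0.
    by do 3!(apply: sumr_ge0 => ? _); apply: sqr_ge0.
  have := sqr_ge0 (`|x| - 1); rewrite -real_normK ?num_real // in x2 *.
  by have := sqr_ge0 `|x|; nra.
exists (bracket_of t) => // c' c'O; have [[c'b _ _] _ _] := c'O.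
have [le|/ltW lt] := leP (sq_norm c') (sq_norm (@lie _ g)).
  have := tmin (constants_of c'); rewrite /f /A /= bracket_ofK //; exact.
by apply: le_trans lt; have := tmin _ lieA; rewrite /f bracket_ofK //; apply: lie_bilin.
Qed.

End Orbit.

(** * Inner products of bilinear maps *)

Section CoordinateForm.
Context {R : realType} {V : vectType R} {n : nat} (e : n.-tuple V).
Hypothesis eB : basis_of {:V} e.

Definition coord_dot (x y : V) : R := \sum_(i < n) coord e i x * coord e i y.

Fact coord_dot_linear (x : V) a (y z : V) :
  coord_dot (a *: y + z) x = a * coord_dot y x + coord_dot z x.
Proof.
rewrite mulr_sumr -big_split; apply: eq_bigr => i _ /=.
by rewrite linearP mulrDl mulrA.
Qed.

Fact coord_dot_sym (x y : V) : coord_dot x y = coord_dot y x.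
Proof. by apply: eq_bigr => i _; rewrite mulrC. Qed.

Fact coord_dot_gt0 (x : V) : x != 0 -> 0 < coord_dot x x.
Proof.
move=> x0; rewrite lt0r sumr_ge0 => [|i _]; last by rewrite -expr2 sqr_ge0.
rewrite andbT; apply: contra_neq x0 => /eqP.
rewrite psumr_eq0 => [/allP h|i _]; last by rewrite -expr2 sqr_ge0.
rewrite (coord_basis eB (memvf x)) big1 // => i _.
have := h i (mem_index_enum i).
by rewrite mulf_eq0 orbb => /eqP ->; rewrite scale0r.
Qed.

Definition coord_ip : inner_product V :=
  InnerProduct coord_dot_linear coord_dot_sym coord_dot_gt0.

Lemma coord_ip_orthonormal : orthonormal coord_ip e.
Proof.
move=> i j /=; rewrite /coord_dot (bigD1 i) //= coord_free ?(basis_free eB) //.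
rewrite eqxx mul1r coord_free ?(basis_free eB) // eq_sym big1 ?addr0 // => k /negPf ki.
by rewrite coord_free ?(basis_free eB) // eq_sym ki mul0r.
Qed.

End CoordinateForm.

Section OrthonormalBases.
Context {R : realType} {V : vectType R} (q : inner_product V).

Lemma parseval n (f : n.-tuple V) x y : basis_of {:V} f -> orthonormal q f ->
  q x y = \sum_(i < n) q f`_i x * q f`_i y.
Proof.
move=> fB fo; rewrite {1}(ip_expand fB fo (memvf x)) ip_suml.
by apply: eq_bigr => i _; rewrite ipZl.
Qed.

Lemma sum_orthonormal (psi : V -> V -> R^o) n m (e : n.-tuple V) (f : m.-tuple V) :
  bilin psi -> basis_of {:V} e -> orthonormal q e ->
  basis_of {:V} f -> orthonormal q f ->
  \sum_(i < n) psi e`_i e`_i = \sum_(j < m) psi f`_j f`_j.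
Proof.
move=> pb eB eo fB fo.
transitivity (\sum_(i < n) \sum_(j < m) q f`_j e`_i * psi f`_j e`_i).
  apply: eq_bigr => i _; rewrite {1}(ip_expand fB fo (memvf e`_i)) (bil_suml pb).
  by apply: eq_bigr => j _; rewrite (bilZl pb).
rewrite exchange_big; apply: eq_bigr => j _ /=.
transitivity (psi f`_j (\sum_(i < n) q e`_i f`_j *: e`_i)); last first.
  by rewrite -(ip_expand eB eo (memvf f`_j)).
rewrite (bil_sumr pb); apply: eq_bigr => i _.
by rewrite (bilZr pb) ip_sym.
Qed.

(** A transposition rule: in a sum over an orthonormal basis, an endomorphism
    moves from one argument to the other as its adjoint. *)
Lemma sum_adjoint (psi : V -> V -> R^o) n (e : n.-tuple V) (D D' : 'End(V)) :
  bilin psi -> basis_of {:V} e -> orthonormal q e ->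
  (forall x y, q (D x) y = q x (D' y)) ->
  \sum_(i < n) psi (D e`_i) e`_i = \sum_(i < n) psi e`_i (D' e`_i).
Proof.
move=> pb eB eo DD'.
transitivity (\sum_(i < n) \sum_(j < n) q e`_i (D' e`_j) * psi e`_j e`_i).
  apply: eq_bigr => i _.
  rewrite {1}(ip_expand eB eo (memvf (D e`_i))) (bil_suml pb).
  by apply: eq_bigr => j _; rewrite (bilZl pb) ip_sym DD'.
rewrite exchange_big; apply: eq_bigr => j _ /=.
rewrite [in RHS](ip_expand eB eo (memvf (D' e`_j))) (bil_sumr pb).
by apply: eq_bigr => i _; rewrite (bilZr pb).
Qed.

Lemma ip_bilin (u v : V -> V -> V) z : bilin u -> bilin v ->
  bilin (fun x y => q (u x z) (v y z) : R^o).
Proof.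
by move=> ub vb; split=> y a x x'; rewrite (bilDl ub, bilDl vb) (bilZl ub, bilZl vb)
  (ip_additive, ipDr) (ipZl, ipZr).
Qed.

Lemma ip_bilin_r (u v : V -> V -> V) z : bilin u -> bilin v ->
  bilin (fun x y => q (u z x) (v z y) : R^o).
Proof.
by move=> ub vb; split=> y a x x'; rewrite (bilDr ub, bilDr vb) (bilZr ub, bilZr vb)
  (ip_additive, ipDr) (ipZl, ipZr).
Qed.

Definition bil_dot n (e : n.-tuple V) (u v : V -> V -> V) : R :=
  \sum_(i < n) \sum_(j < n) q (u e`_i e`_j) (v e`_i e`_j).

Lemma bil_dot_basis n m (e : n.-tuple V) (f : m.-tuple V) u v :
  bilin u -> bilin v -> basis_of {:V} e -> orthonormal q e ->
  basis_of {:V} f -> orthonormal q f -> bil_dot e u v = bil_dot f u v.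
Proof.
move=> ub vb eB eo fB fo; rewrite /bil_dot.
transitivity (\sum_(i < n) \sum_(j < m) q (u e`_i f`_j) (v e`_i f`_j)).
  by apply: eq_bigr => i _; apply: sum_orthonormal (ip_bilin_r _ ub vb) _ _ _ _.
rewrite exchange_big [RHS]exchange_big; apply: eq_bigr => j _ /=.
exact: sum_orthonormal (ip_bilin _ ub vb) _ _ _ _.
Qed.

(** The action of gl(V) on bilinear maps.  A bracket is killed by [D] exactly
    when [D] is a derivation of it. *)
Definition der_act (D : 'End(V)) (u : V -> V -> V) (x y : V) : V :=
  D (u x y) - u (D x) y - u x (D y).

Lemma der_act_bilin D u : bilin u -> bilin (der_act D u).
Proof.
have DP b v w : D (b *: v + w) = b *: D v + D w by apply: linearP.
move=> ub; split=> z a x y; rewrite /der_act.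
  rewrite !DP !(bilDl ub, bilZl ub) !DP.
  by rewrite !scalerBr !opprD !addrA; rewrite [LHS](AC (6) (1*3*5*2*4*6)).
rewrite !DP !(bilDr ub, bilZr ub) !DP.
by rewrite !scalerBr !opprD !addrA; rewrite [LHS](AC (6) (1*3*5*2*4*6)).
Qed.

Lemma bil_dot_adjoint n (e : n.-tuple V) (D D' : 'End(V)) u v :
  bilin u -> bilin v -> basis_of {:V} e -> orthonormal q e ->
  (forall x y, q (D x) y = q x (D' y)) ->
  bil_dot e (der_act D u) v = bil_dot e u (der_act D' v).
Proof.
move=> ub vb eB eo DD'; rewrite /bil_dot /der_act.
transitivity (
    \sum_(i < n) \sum_(j < n) q (D (u e`_i e`_j)) (v e`_i e`_j)
  - \sum_(i < n) \sum_(j < n) q (u (D e`_i) e`_j) (v e`_i e`_j)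
  - \sum_(i < n) \sum_(j < n) q (u e`_i (D e`_j)) (v e`_i e`_j)).
  rewrite -!sumrB; apply: eq_bigr => i _; rewrite -!sumrB; apply: eq_bigr => j _.
  by rewrite !ip_additive !ipNl.
transitivity (
    \sum_(i < n) \sum_(j < n) q (u e`_i e`_j) (D' (v e`_i e`_j))
  - \sum_(i < n) \sum_(j < n) q (u e`_i e`_j) (v (D' e`_i) e`_j)
  - \sum_(i < n) \sum_(j < n) q (u e`_i e`_j) (v e`_i (D' e`_j))); last first.
  rewrite -!sumrB; apply: eq_bigr => i _; rewrite -!sumrB; apply: eq_bigr => j _.
  by rewrite !ipDr !ipNr.
congr (_ - _ - _).
- by do 2!(apply: eq_bigr => ? _); rewrite DD'.
- rewrite exchange_big [RHS]exchange_big; apply: eq_bigr => j _ /=.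
  exact: sum_adjoint (ip_bilin _ ub vb) _ _ DD'.
- by apply: eq_bigr => i _; apply: sum_adjoint (ip_bilin_r _ ub vb) _ _ DD'.
Qed.

End OrthonormalBases.

(** The inverse of [1 - x <= expR (- x)]. *)
Lemma expR_le_quadratic (R : realType) (x : R) : `|x| <= 2^-1 ->
  expR x <= 1 + x + 2 * x ^+ 2.
Proof.
rewrite ler_norml => /andP[xl xu].
have x1 : 0 < 1 - x by lra.
have ge : 1 - x <= expR (- x) by apply: expR_ge1Dx.
have le : expR x * (1 - x) <= 1.
  apply: (@le_trans _ _ (expR x * expR (- x))).
    by rewrite ler_wpM2l // expR_ge0.
  by rewrite -expRD subrr expR0.
rewrite -(ler_pM2r x1); apply: le_trans le _.
have -> : (1 + x + 2 * x ^+ 2) * (1 - x) = 1 + x ^+ 2 * (1 - 2 * x) by ring.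
by rewrite lerDl mulr_ge0 ?sqr_ge0 //; lra.
Qed.

(** The conclusion is the vanishing of the derivative at its minimum [t = 0] of
    the function on the right-hand side. *)
Lemma exp_sum_min (R : realType) (I : finType) (a w : I -> R) :
  (forall i, 0 <= a i) ->
  (forall t, \sum_i a i <= \sum_i a i * expR (t * w i)) -> \sum_i a i * w i = 0.
Proof.
move=> a0 min; set S := \sum_i _; pose Q := \sum_i a i * w i ^+ 2.
pose W := \sum_i `|w i|.
have W0 : 0 <= W by apply: sumr_ge0.
have Q0 : 0 <= Q by apply: sumr_ge0 => i _; rewrite mulr_ge0 ?sqr_ge0.
have wW i : `|w i| <= W by rewrite /W (bigD1 i) //= lerDl sumr_ge0.
have quad t : `|t| * W <= 2^-1 -> 0 <= t * S + 2 * t ^+ 2 * Q.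
  move=> tW; have : \sum_i a i <= \sum_i a i * (1 + t * w i + 2 * (t * w i) ^+ 2).
    apply: le_trans (min t) _; apply: ler_sum => i _; rewrite ler_wpM2l //.
    apply: expR_le_quadratic; rewrite normrM; apply: le_trans tW.
    by rewrite ler_wpM2l.
  rewrite -subr_ge0 -sumrB /S /Q !mulr_sumr -big_split /=.
  by congr (0 <= _); apply: eq_bigr => i _; ring.
(* The value [t = - S / d] contradicts [quad] unless [S = 0]. *)
pose d := 2 * (1 + 2 * Q + `|S| * W).
have SW0 : 0 <= `|S| * W by rewrite mulr_ge0.
have d0 : 0 < d by rewrite /d; lra.
have := quad (- S / d); rewrite normrM normrN [`|d^-1|]gtr0_norm ?invr_gt0 //.
rewrite mulrAC ler_pdivrMr // => h.
have {}h : 0 <= - S / d * S + 2 * (- S / d) ^+ 2 * Q by apply: h; rewrite /d; lra.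
apply/eqP; apply: contraT => S0.
have S2 : 0 < (S / d) ^+ 2 by rewrite exprn_even_gt0 //= mulf_neq0 ?invr_neq0 // gt_eqF.
have : 0 <= (S / d) ^+ 2 * (2 * Q - d).
  by apply: le_trans h _; rewrite le_eqVlt; apply/orP; left; apply/eqP; field; rewrite gt_eqF.
rewrite pmulr_rge0 // /d; lra.
Qed.

(** * A bracket of minimal norm has a Cartan involution *)

Section MinimalBracket.
Context {R : realType} {g : lieAlgType R} {n : nat} (e : n.-tuple g) (s : 'I_n -> R).
Hypothesis eB : basis_of {:g} e.
Hypothesis ss : forall i, s i * s i = 1.
Hypothesis es : forall i j : 'I_n, killing e`_i e`_j = s i * (i == j)%:R.

Variable q : inner_product g.
Hypothesis eo : orthonormal q e.

Lemma sq_normE c : sq_norm e c = bil_dot q e c c.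
Proof.
apply: eq_bigr => i _; apply: eq_bigr => j _.
rewrite (parseval _ _ eB eo); apply: eq_bigr => k _.
by rewrite (ip_coord eB eo) ?memvf // expr2.
Qed.

Hypothesis minimal : forall h hi : 'End(g), cancel h hi -> cancel hi h ->
  (forall x y, killing (h x) (h y) = killing x y) ->
  sq_norm e (@lie _ g) <= sq_norm e (fun x y => h (lie (hi x) (hi y))).

(** In an orthonormal basis of eigenvectors of [S], the isometry [exp (t S)] of
    the Killing form multiplies the structure constant with indices [i], [j], [k]
    by [exp (t (mu k - mu i - mu j))]; minimality at [t = 0] is a statement about
    a sum of exponentials, to which [exp_sum_min] applies. *)
Lemma minimal_critical (S : 'End(g)) :
  (forall x y, q (S x) y = q x (S y)) ->
  (forall x y, killing (S x) y = - killing x (S y)) ->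
  bil_dot q e (der_act S (@lie _ g)) (@lie _ g) = 0.
Proof.
move=> Ssym Sskew; have [f [mu [fB fo fS]]] := spectral Ssym.
have lb := lie_bilin g.
rewrite (bil_dot_basis (der_act_bilin S lb) lb eB eo fB fo).
set m := \dim {:g} in f mu fB fo fS *.
pose beta (i j k : 'I_m) := q f`_k (lie f`_i f`_j) ^+ 2.
have normf (v : g) : q v v = \sum_(k < m) q f`_k v ^+ 2.
  by rewrite (parseval _ _ fB fo); apply: eq_bigr => k _; rewrite expr2.
have goalE : bil_dot q f (der_act S (@lie _ g)) (@lie _ g) =
    \sum_(i < m) \sum_(j < m) \sum_(k < m) (mu k - mu i - mu j) * beta i j k.
  apply: eq_bigr => i _; apply: eq_bigr => j _.
  rewrite /der_act !fS lieZl (bilZr lb) !ip_additive !ipNl !ipZl normf.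
  rewrite (parseval (S _) _ fB fo) !mulr_sumr -!sumrB; apply: eq_bigr => k _.
  by rewrite -Ssym fS ipZl /beta; ring.
pose h t : 'End(g) := diag_lfun f (fun i => expR (t * mu i)).
have hf t (i : 'I_m) : h t f`_i = expR (t * mu i) *: f`_i by apply: diag_lfunE.
have hK t : cancel (h t) (h (- t)).
  move=> x; have /lfunP/(_ x) : (h (- t) \o h t)%VF = \1%VF.
    apply: (basis_ext fB) => i; rewrite comp_lfunE id_lfunE hf linearZ /= hf.
    by rewrite scalerA -expRD mulNr subrr expR0 scale1r.
  by rewrite comp_lfunE id_lfunE.
(* [S] is skew, so eigenvectors are orthogonal for the Killing form unless their
   eigenvalues are opposite. *)
have Bf (i j : 'I_m) : (mu i + mu j) * killing f`_i f`_j = 0.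
  have := Sskew f`_i f`_j; rewrite !fS killingZl killingZr => /eqP.
  by rewrite -subr_eq0 opprK -mulrDl => /eqP.
have hBf t (i j : 'I_m) : killing (h t f`_i) (h t f`_j) = killing f`_i f`_j.
  rewrite !hf killingZl killingZr.
  have [b0|b0] := eqVneq (killing f`_i f`_j) 0; first by rewrite b0 !mulr0.
  have /eqP := Bf i j; rewrite mulf_eq0 (negPf b0) orbF => /eqP ij0.
  by rewrite mulrA -expRD -mulrDr ij0 mulr0 expR0 mul1r.
have hB t x y : killing (h t x) (h t y) = killing x y.
  rewrite [in RHS](coord_basis fB (memvf x)) [in RHS](coord_basis fB (memvf y)).
  rewrite [in LHS](coord_basis fB (memvf x)) [in LHS](coord_basis fB (memvf y)).
  have kb := @killing_bilin R g.
  have expand (u : 'I_m -> R) : h t (\sum_(i < m) u i *: f`_i) = \sum_(i < m) u i *: h t f`_i.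
    by rewrite linear_sum; apply: eq_bigr => i _; rewrite linearZ.
  rewrite !expand !(bil_suml kb); apply: eq_bigr => i _.
  rewrite !(bil_sumr kb); apply: eq_bigr => j _.
  by rewrite !killingZl !killingZr hBf.
pose w (p : 'I_m * 'I_m * 'I_m) := 2 * (mu p.2 - mu p.1.1 - mu p.1.2).
pose a (p : 'I_m * 'I_m * 'I_m) := beta p.1.1 p.1.2 p.2.
have flat (F : 'I_m * 'I_m * 'I_m -> R) :
    \sum_p F p = \sum_(i < m) \sum_(j < m) \sum_(k < m) F (i, j, k).
  by rewrite pair_big pair_big; apply: eq_bigr => [[[? ?] ?]].
have a0 p : 0 <= a p by apply: sqr_ge0.
have qh t (k : 'I_m) v : q f`_k (h t v) = expR (t * mu k) * q f`_k v.
  rewrite lin_homE ip_sumr (bigD1 k) //= ipZr fo eqxx mulr1 (ip_coord fB fo) ?memvf //.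
  by rewrite big1 ?addr0 // => i /negPf ik; rewrite ipZr fo eq_sym ik mulr0.
have dot t : bil_dot q f (fun x y => h t (lie (h (- t) x) (h (- t) y)))
    (fun x y => h t (lie (h (- t) x) (h (- t) y))) = \sum_p a p * expR (t * w p).
  rewrite flat; apply: eq_bigr => i _; apply: eq_bigr => j _.
  rewrite normf; apply: eq_bigr => k _; rewrite qh !hf lieZl (bilZr lb) !ipZr.
  have -> : expR (t * w (i, j, k)) =
      (expR (t * mu k) * (expR (- t * mu i) * expR (- t * mu j))) ^+ 2.
    by rewrite -!expRD expr2 -expRD /w; congr expR => /=; ring.
  by rewrite /a /beta /=; ring.
have key : \sum_p a p * w p = 2 * bil_dot q f (der_act S (@lie _ g)) (@lie _ g).
  rewrite flat goalE mulr_sumr; apply: eq_bigr => i _; rewrite mulr_sumr.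
  apply: eq_bigr => j _; rewrite mulr_sumr; apply: eq_bigr => k _.
  by rewrite /w /a /=; ring.
apply: (@mulfI _ 2); first by rewrite pnatr_eq0.
rewrite mulr0 -key; apply: exp_sum_min => // t; rewrite -dot.
have hiK : cancel (h (- t)) (h t) by have := hK (- t); rewrite opprK.
have := minimal (hK t) hiK (hB t).
rewrite !sq_normE.
have cb : bilin (fun x y => h t (lie (h (- t) x) (h (- t) y))).
  have hP r b v v' : h r (b *: v + v') = b *: h r v + h r v' by apply: linearP.
  by split=> z b x y; rewrite hP ?lieDl ?lieZl ?(bilDr lb) ?(bilZr lb) hP.
rewrite (bil_dot_basis lb lb eB eo fB fo) (bil_dot_basis cb cb eB eo fB fo).
congr (_ <= _); rewrite flat; apply: eq_bigr => i _; apply: eq_bigr => j _.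
by rewrite normf.
Qed.

Definition is_derivation (F : 'End(g)) : Prop :=
  forall x y, F (lie x y) = lie (F x) y + lie x (F y).

Lemma lie_inj (z z' : g) : (forall y, lie z y = lie z' y) -> z = z'.
Proof.
move=> zz'; have az : ad z = ad z' by apply/lfunP => y; rewrite !adE.
by apply: (killing_nondeg eB ss es) => y; rewrite /killing az.
Qed.

(** The vector that represents the linear form [y |-> tr (F o ad y)] with respect
    to the Killing form. *)
Definition inner_of (F : 'End(g)) : g :=
  \sum_(l < n) (s l * lfun_trace (F \o ad e`_l)%VF) *: e`_l.

Lemma killing_inner_of F y : killing (inner_of F) y = lfun_trace (F \o ad y)%VF.
Proof.
have base (l : 'I_n) : killing (inner_of F) e`_l = lfun_trace (F \o ad e`_l)%VF.
  rewrite (killing_coord eB es) /inner_of linear_sum (bigD1 l) //= linearZ /=.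
  rewrite coord_free ?(basis_free eB) // eqxx mulr1 big1 ?addr0 ?mulrA ?ss ?mul1r //.
  by move=> k /negPf kl; rewrite linearZ /= coord_free ?(basis_free eB) // kl mulr0.
pose k y : R^o := killing (inner_of F) y; pose t y : R^o := lfun_trace (F \o ad y)%VF.
have kL : linear k by move=> a x z; rewrite /k killingDr killingZr.
have tL : linear t.
  by move=> a x z; rewrite /t adD adZ comp_lfunDr -comp_lfunZr traceD traceZ.
have /lfunP/(_ y) : lin_hom kL = lin_hom tL.
  by apply: (basis_ext eB) => l; rewrite !lin_homE; apply: base.
by rewrite !lin_homE.
Qed.

(** For a derivation, [ad (F y)] is the commutator of [F] and [ad y]; so
    [killing (F y) w] is the trace of [F o ad (lie y w)]. *)
Lemma derivation_inner F : is_derivation F -> forall y, lie (inner_of F) y = F y.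
Proof.
move=> Fder y; apply: (killing_nondeg eB ss es) => w.
have adF : ad (F y) = ((F \o ad y)%VF - (ad y \o F)%VF)%R.
  apply/lfunP => v; rewrite add_lfunE opp_lfunE !comp_lfunE !adE Fder.
  by rewrite addrK.
rewrite [RHS]/killing adF comp_lfunDl comp_lfunNl traceD traceN.
rewrite -!comp_lfunA (traceC (F \o ad w)%VF (ad y)) -comp_lfunA -traceN -comp_lfunNr.
rewrite -traceD -comp_lfunDr -ad_lie -killing_inner_of.
by rewrite lieC killingNl killing_lie opprK.
Qed.

(** The inner product and the Killing form are both diagonal in [e], and up to sign
    they differ by this involution of the vector space [g]. *)
Let theta0 : 'End(g) := diag_lfun e (fun i => - s i).

Lemma theta0N x : theta0 (- x) = - theta0 x.
Proof. exact: linearN. Qed.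

Lemma theta00 : theta0 0 = 0.
Proof. exact: linear0. Qed.

Lemma theta0K x : theta0 (theta0 x) = x.
Proof.
have /lfunP/(_ x) : (theta0 \o theta0)%VF = \1%VF; last by rewrite comp_lfunE id_lfunE.
apply: (basis_ext eB) => i; rewrite comp_lfunE id_lfunE !(diag_lfunE eB) linearZ /=.
by rewrite (diag_lfunE eB) scalerA mulrNN ss scale1r.
Qed.

Lemma coord_theta0 x (i : 'I_n) : coord e i (theta0 x) = - s i * coord e i x.
Proof.
rewrite lin_homE linear_sum (bigD1 i) //= linearZ /= coord_free ?(basis_free eB) //.
rewrite eqxx mulr1 big1 ?addr0 // => j /negPf ji.
by rewrite linearZ /= coord_free ?(basis_free eB) // ji mulr0.
Qed.

Lemma killing_theta0 x y : killing x (theta0 y) = - q x y.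
Proof.
rewrite (parseval _ _ eB eo) {1}(coord_basis eB (memvf x)).
rewrite (bil_suml (@killing_bilin R g)) -sumrN; apply: eq_bigr => i _.
rewrite killingZl killingC (killing_coord eB es) coord_theta0 !(ip_coord eB eo) ?memvf //.
by rewrite mulNr mulrN mulrA ss mul1r mulrN.
Qed.

Lemma theta0_sym x y : killing (theta0 x) y = killing x (theta0 y).
Proof. by rewrite killingC !killing_theta0 ip_sym. Qed.

(** For an endomorphism that is skew for the Killing form, this is the adjoint
    for the inner product. *)
Definition transpose (D : 'End(g)) : 'End(g) := (- (theta0 \o (D \o theta0))%VF)%R.

Lemma transposeE D x : transpose D x = - theta0 (D (theta0 x)).
Proof. by rewrite opp_lfunE !comp_lfunE. Qed.

Lemma transpose_adjoint (D : 'End(g)) :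
  (forall x y, killing (D x) y = - killing x (D y)) ->
  forall x y, q (D x) y = q x (transpose D y).
Proof.
move=> Dskew x y; apply: oppr_inj; rewrite -!killing_theta0 transposeE.
by rewrite theta0N theta0K Dskew killingNr.
Qed.

Lemma transpose_skew (D : 'End(g)) :
  (forall x y, killing (D x) y = - killing x (D y)) ->
  forall x y, killing (transpose D x) y = - killing x (transpose D y).
Proof.
by move=> Dskew x y; rewrite !transposeE killingNl killingNr theta0_sym Dskew theta0_sym.
Qed.

Lemma der_act_commutator (D E : 'End(g)) u x y : bilin u ->
  der_act ((D \o E)%VF - (E \o D)%VF)%R u x y =
  der_act D (der_act E u) x y - der_act E (der_act D u) x y.
Proof.
move=> ub; have NB (F : 'End(g)) v w : F (v - w) = F v - F w by apply: linearB.
rewrite /der_act !add_lfunE !opp_lfunE !comp_lfunE !(bilBl ub) !(bilBr ub) !NB.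
rewrite !opprD !opprK !addrA; apply/esym; rewrite [LHS](AC 18
  ((1*10*14*5*18*9)*(2*13)*(3*16)*(4*11)*(7*12)*(6*17)*(8*15))) /=.
by rewrite !subrr !addNr !addr0.
Qed.

(** Let [D = ad x], let [E] be its transpose and [b] the bracket.  As [D] kills
    [b], the derivative of the norm of [b] in the direction of the symmetric
    endomorphism [D E - E D] is the product of [D E b] with [b], which is the
    square of the norm of [E b].  It vanishes by [minimal_critical]. *)
Lemma transpose_ad_derivation x : is_derivation (transpose (ad x)).
Proof.
have lb := lie_bilin g.
have Dskew (y z : g) : killing (ad x y) z = - killing y (ad x z).
  by rewrite !adE killing_lie.
set D := ad x in Dskew *; set E := transpose D.
have adj := transpose_adjoint Dskew; rewrite -/E in adj.
have adj' y z : q (E y) z = q y (D z) by rewrite ip_sym -adj ip_sym.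
have Eskew := transpose_skew Dskew; rewrite -/E in Eskew.
pose S := ((D \o E)%VF - (E \o D)%VF)%R.
have SE y : S y = D (E y) - E (D y) by rewrite add_lfunE opp_lfunE !comp_lfunE.
have Ssym y z : q (S y) z = q y (S z).
  by rewrite !SE ip_additive ipDr ipNl ipNr !adj !adj' !adj.
have Sskew y z : killing (S y) z = - killing y (S z).
  rewrite !SE killingDl killingNl killingDr killingNr Dskew !Eskew Dskew.
  by rewrite !opprK opprB.
have D0 y z : der_act D (@lie _ g) y z = 0.
  by rewrite /der_act /D !adE lie_jacobil subKr subrr.
have ED0 y z : der_act E (der_act D (@lie _ g)) y z = 0.
  have -> : der_act D (@lie _ g) = fun _ _ => 0.
    by apply: funext => a; apply: funext => b; apply: D0.
  by rewrite /der_act linear0 !subr0.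
pose w := der_act E (@lie _ g); have wb : bilin w := der_act_bilin E lb.
have := minimal_critical Ssym Sskew.
have -> : bil_dot q e (der_act S (@lie _ g)) (@lie _ g) =
    bil_dot q e (der_act D w) (@lie _ g).
  apply: eq_bigr => i _; apply: eq_bigr => j _.
  by rewrite der_act_commutator // ED0 subr0.
rewrite (bil_dot_adjoint wb lb eB eo adj) -/w => ww0.
have we (i j : 'I_n) : w e`_i e`_j = 0.
  apply: (@ip_eq0 _ _ q); move: ww0 => /eqP.
  rewrite psumr_eq0 => [/allP/(_ i (mem_index_enum i))|k _]; last first.
    by apply: sumr_ge0 => l _; apply: ip_ge0.
  rewrite psumr_eq0 => [/allP/(_ j (mem_index_enum j))/eqP //|l _].
  exact: ip_ge0.
move=> y z; have : w y z = 0.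
  rewrite (coord_basis eB (memvf y)) (bil_suml wb) big1 // => i _.
  rewrite (bilZl wb) (coord_basis eB (memvf z)) (bil_sumr wb) big1 ?scaler0 // => j _.
  by rewrite (bilZr wb) we scaler0.
rewrite /w /der_act => /eqP; rewrite subr_eq0 subr_eq => /eqP ->.
by rewrite addrC.
Qed.

(** The involution is given by [ad (tau x) = - transpose (ad x)], so that
    [- killing x (tau x)] is the square of the norm of [transpose (ad x)]. *)
Theorem minimal_cartan : exists theta : involution g, cartan_involution theta.
Proof.
have lb := lie_bilin g.
pose F (x : g) : 'End(g) := (theta0 \o (ad x \o theta0))%VF.
have FE x y : F x y = theta0 (lie x (theta0 y)) by rewrite !comp_lfunE adE.
pose tau x := inner_of (F x).
have tauE x y : lie (tau x) y = theta0 (lie x (theta0 y)).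
  rewrite -FE; apply: derivation_inner => v w.
  have := transpose_ad_derivation x v w.
  by rewrite !transposeE !adE -!FE lieNl (bilNr lb) -opprD => /oppr_inj.
have tauL : linear tau.
  move=> a x y; apply: lie_inj => v; rewrite lieDl lieZl !tauE lieDl lieZl.
  by rewrite linearP.
have tau_hom : lie_hom (lin_hom tauL).
  move=> x y; rewrite !lin_homE; apply: lie_inj => v.
  by rewrite tauE !lie_jacobil !tauE !theta0K linearB.
have tauK x : lin_hom tauL (lin_hom tauL x) = x.
  by rewrite !lin_homE; apply: lie_inj => v; rewrite !tauE !theta0K.
exists (Involution tau_hom tauK) => x x0 /=; rewrite lin_homE.
have adj := @transpose_adjoint (ad x) _.
rewrite /killing (trace_orthonormal _ eB eo) -sumrN.
have term i : - q e`_i ((ad x \o ad (tau x))%VF e`_i) = q (F x e`_i) (F x e`_i).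
  rewrite comp_lfunE !adE ip_sym -adE adj; last first.
    by move=> y z; rewrite !adE killing_lie.
  by rewrite transposeE adE ipNr opprK -FE -adE adE tauE -FE.
under eq_bigr do rewrite term.
rewrite lt0r sumr_ge0 => [|i _]; last exact: ip_ge0.
rewrite andbT; apply: contra_neq x0 => /eqP.
rewrite psumr_eq0 => [/allP h|i _]; last exact: ip_ge0.
have Fx : F x = 0%R.
  apply: (basis_ext eB) => i; rewrite zero_lfunE; apply: (@ip_eq0 _ _ q).
  exact/eqP/h/mem_index_enum.
rewrite -[x]tauK !lin_homE; apply: lie_inj => v.
by rewrite tauE tauE -FE Fx zero_lfunE theta00 lie0l.
Qed.

End MinimalBracket.

(** * Existence of Cartan involutions *)

Lemma cartan_pullback (R : realType) (g g' : lieAlgType R) (f : 'Hom(g, g'))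
    (theta' : involution g') : lie_iso f -> cartan_involution theta' ->
  exists2 theta : involution g, cartan_involution theta &
    intertwines f theta theta'.
Proof.
move=> fi t'C; have [h [hi fK hK]] := lie_iso_inv fi.
have pull_hom : lie_hom (h \o (theta' \o f))%VF.
  by move=> x y; rewrite !comp_lfunE fi.2 inv_hom hi.2.
have pullK x : (h \o (theta' \o f))%VF ((h \o (theta' \o f))%VF x) = x.
  by rewrite !comp_lfunE hK invK fK.
exists (Involution pull_hom pullK) => [x x0|x] /=; rewrite !comp_lfunE ?hK //.
rewrite -(killing_iso _ _ fi) hK; apply: t'C.
by apply: contra_neq x0 => fx; rewrite -[x]fK fx linear0.
Qed.

Section Existence.
Context {R : realType} {g : lieAlgType R}.

(** Diagonalise the Killing form with respect to an inner product, and rescale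
    the eigenvectors; the eigenvalues are not zero by semisimplicity. *)
Lemma killing_basis : semisimple g ->
  exists (e : (\dim {:g}).-tuple g) (s : 'I_(\dim {:g}) -> R),
  [/\ basis_of {:g} e, forall i, s i * s i = 1 &
      forall i j : 'I_(\dim {:g}), killing e`_i e`_j = s i * (i == j)%:R].
Proof.
move=> gss; set n := \dim _.
pose q := coord_ip (vbasisP {:g}).
have bo : orthonormal q (vbasis {:g}) := coord_ip_orthonormal (vbasisP {:g}).
have ML : linear (fun x : g => \sum_(i < n) killing x (vbasis {:g})`_i *: (vbasis {:g})`_i).
  move=> a x y; rewrite scaler_sumr -big_split; apply: eq_bigr => i _ /=.
  by rewrite killingDl killingZl scalerDl scalerA.
have ME x y : q (lin_hom ML x) y = killing x y.
  rewrite lin_homE ip_suml [in RHS](ip_expand (vbasisP {:g}) bo (memvf y)).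
  rewrite (bil_sumr (@killing_bilin R g)); apply: eq_bigr => i _.
  by rewrite killingZr ipZl mulrC.
have Msym x y : q (lin_hom ML x) y = q x (lin_hom ML y).
  by rewrite ME killingC -ME ip_sym.
have [f [lam [fB fo fM]]] := spectral Msym.
have kf (i j : 'I_n) : killing f`_i f`_j = lam i * (i == j)%:R.
  by rewrite -ME fM ipZl fo.
have lam0 i : lam i != 0.
  apply/eqP => l0; have : f`_i = 0.
    by apply: gss => y; rewrite -ME fM l0 scale0r ip0l.
  by move=> f0; have /eqP := fo i i; rewrite f0 ip0l eqxx eq_sym oner_eq0.
pose r i := Num.sqrt `|lam i|.
have r0 i : r i != 0 by rewrite gt_eqF // sqrtr_gt0 normr_gt0.
pose s i := Num.sg (lam i).
have ss i : s i * s i = 1 by rewrite /s -expr2 sqr_sg lam0.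
pose e := [tuple (r i)^-1 *: f`_i | i < n].
have eE (i : 'I_n) : e`_i = (r i)^-1 *: f`_i by rewrite -tnth_nth tnth_mktuple.
have es (i j : 'I_n) : killing e`_i e`_j = s i * (i == j)%:R.
  rewrite !eE killingZl killingZr kf; have [<-|] := eqVneq i j; last by rewrite !mulr0.
  rewrite !mulr1 mulrA -invfM -expr2 sqr_sqrtr // {2}[lam i]numEsg mulrCA.
  by rewrite mulVf ?mulr1 // normr_eq0.
exists e, s; split=> //; rewrite basisEfree; apply/and3P; split.
- apply/freeP => k k0 i.
  have : killing (\sum_(j < n) k j *: e`_j) e`_i = 0 by rewrite [X in killing X]k0 killing0l.
  rewrite (bil_suml (@killing_bilin R g)) (bigD1 i) //= big1 => [|j /negPf ji]; last first.
    by rewrite killingZl es ji !mulr0.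
  rewrite addr0 killingZl es eqxx mulr1 => /eqP; rewrite mulf_eq0 => /orP[/eqP //|].
  by rewrite sgr_eq0 (negPf (lam0 i)).
- exact: subvf.
- by rewrite size_tuple.
Qed.

(** The isomorphic bracket of minimal norm has a Cartan involution, which is then
    transported to [g]. *)
Theorem cartan_involution_exists :
  semisimple g -> exists theta : involution g, cartan_involution theta.
Proof.
move=> gss; have [e [s [eB ss es]]] := killing_basis gss.
have [c [cP form [h0 [hi0 [h0K hi0K h0h]]]] cmin] := minimal_bracket eB ss es.
have [cb c0 cJ] := cP.
have es' (i j : 'I_(\dim {:g})) :
    killing (e`_i : twist cP) e`_j = s i * (i == j)%:R.
  by rewrite (killing_twist eB) form es.
have minimal (h hi : 'End(twist cP)) : cancel h hi -> cancel hi h ->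
    (forall x y, killing (h x) (h y) = killing x y) ->
    sq_norm e (@lie _ (twist cP)) <= sq_norm e (fun x y => h (lie (hi x) (hi y))).
  move=> hK hiK hB; apply: cmin.
  pose c' (x y : g) : g := h (c (hi x) (hi y)).
  have hP (k : 'End(twist cP)) a (v w : g) : k (a *: v + w) = a *: k v + k w.
    exact: linearP.
  have c'P : lie_bracket c'.
    split=> [|x|x y z]; rewrite /c'.
    - split=> z a x y; first by rewrite hP (bilDl cb) (bilZl cb) hP.
      by rewrite hP (bilDr cb) (bilZr cb) hP.
    - by rewrite c0 linear0.
    - have hD v w : h v + h w = h (v + w) by rewrite linearD.
      by rewrite !hK !hD cJ linear0.
  split=> //.
    pose H : 'Hom(twist cP, twist c'P) := h.
    have Hi : lie_iso H.
      by split; [exists hi | move=> x y; rewrite !twist_lie /c' !hK].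
    move=> x y; rewrite -(@killing_twist _ _ _ _ eB _ c'P) -[x]hiK -[y]hiK.
    rewrite [LHS](killing_iso _ _ Hi) -hB !hiK (killing_twist eB).
    exact: form.
  exists (h \o h0)%VF, (hi0 \o hi)%VF; split=> [x|x|x y].
  - by rewrite !comp_lfunE hK h0K.
  - by rewrite !comp_lfunE hi0K hiK.
  - by rewrite !comp_lfunE h0h /= !hK.
have [theta tC] := @minimal_cartan R (twist cP) _ e s eB ss es' _
  (coord_ip_orthonormal eB) minimal.
have h0i : lie_iso (h0 : 'Hom(g, twist cP)).
  by split; [exists hi0 | exact: h0h].
by have [theta' t'C _] := cartan_pullback h0i tC; exists theta'.
Qed.

End Existence.

(** * The correspondence *)

Section Correspondence.
Context {R : realType}.

(** An isomorphism of pairs carries the Cartan involution of the second pair to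
    one of the first pair that commutes with sigma, and the two Cartan involutions
    of the first pair are conjugate by [cartan_conjugate]. *)
Lemma ptilde_inj : injective (ptilde R).
Proof.
move=> c c'; have [p ->] := class_of_surj c; have [p' ->] := class_of_surj c'.
rewrite /ptilde !quotient_mapE => /class_ofP[f fi fs]; apply/class_ofP.
have [h [hi fK hK]] := lie_iso_inv fi.
have hs := intertwines_inv fK hK fs.
have [theta1 t1C t1f] := cartan_pullback fi (@cartan_thetaP _ p').
have t1E x : theta1 x = h (cartan_theta p' (f x)) by rewrite -t1f fK.
have t1s x : theta1 (pair_sigma p x) = pair_sigma p (theta1 x).
  by rewrite !t1E fs cartan_comm hs.
have [phi [phi_iso phis phit]] :=
  cartan_conjugate t1C (@cartan_thetaP _ p) t1s (@cartan_comm _ p).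
exists (f \o phi)%VF; split; first exact: lie_iso_comp.
  by move=> x; rewrite !comp_lfunE phis fs.
by move=> x; rewrite !comp_lfunE phit t1E hK.
Qed.

Lemma ptilde_surj c : exists c', ptilde R c' = c.
Proof.
have [p ->] := class_of_surj c.
have [theta0 t0C] := cartan_involution_exists (@pair_semisimple _ p).
have [theta tC ts] := cartan_commuting (pair_sigma p) t0C.
by exists (class_of _ (CartanPair tC ts)); rewrite /ptilde quotient_mapE.
Qed.

Lemma Phi_Psi : cancel (Phi R) (Psi R).
Proof.
move=> c; have [t ->] := class_of_surj c.
rewrite /Phi /Psi !quotient_mapE; apply/class_ofP.
exists (undual (triad_theta1 t)); split; first exact: undual_iso.
  exact: undual_intertwines.
exact: undual_intertwines.
Qed.

Lemma Psi_Phi : cancel (Psi R) (Phi R).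
Proof.
move=> c; have [p ->] := class_of_surj c.
rewrite /Phi /Psi !quotient_mapE; apply/class_ofP.
exists (undual (cartan_theta p)); split; first exact: undual_iso.
  exact: undual_intertwines.
exact: undual_intertwines.
Qed.

End Correspondence.

Theorem theorem3p6 (R : realType) :
  [/\ bijective (ptilde R \o Phi R),
      exists ptilde_inv :
          quotient (@pair_equiv R) -> quotient (@cartan_equiv R),
        [/\ cancel (ptilde R) ptilde_inv,
            cancel ptilde_inv (ptilde R),
            cancel (ptilde R \o Phi R) (Psi R \o ptilde_inv) &
            cancel (Psi R \o ptilde_inv) (ptilde R \o Phi R)] &
      exists F : quotient (@triad_equiv R) -> quotient (@pair_equiv R),
        bijective F].
Proof.
have [pinv pK] : exists pinv, cancel pinv (ptilde R).
  exists (fun c => sval (cid (ptilde_surj c))) => c.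
  by case: (cid _).
have Kp : cancel (ptilde R) pinv by move=> c; apply: ptilde_inj; rewrite pK.
have l : cancel (ptilde R \o Phi R) (Psi R \o pinv).
  by move=> c /=; rewrite Kp Phi_Psi.
have r : cancel (Psi R \o pinv) (ptilde R \o Phi R).
  by move=> c /=; rewrite Psi_Phi pK.
split; first by exists (Psi R \o pinv).
  by exists pinv; split.
by exists (ptilde R \o Phi R), (Psi R \o pinv).
Qed.
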